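(* Let $z\in(0,1)$ and let $\rho\in\mathcal M(X)$. Let $B$ be the Bayes kernel from $\mathcal M^{\cdot\cdot}(X)$ to $\mathcal M(X)$ of the Pólya sum process $\mathsf S_{z,\rho}$ with prior $\mathsf D_{z,\rho}$, i.e. the stochastic kernel satisfying $$\iint f(\mu,\kappa)\,\mathbf P_{\kappa}(\mathrm d\mu)\,\mathsf D_{z,\rho}(\mathrm d\kappa)=\iint f(\mu,\kappa)\,B(\mu,\mathrm d\kappa)\,\mathsf S_{z,\rho}(\mathrm d\mu)$$ for all non-negative measurable $f$ on $\mathcal M^{\cdot\cdot}(X)\times\mathcal M(X)$. Then the posterior is again a Poisson-Gamma random measure: for $\mathsf S_{z,\rho}$-almost every $\mu\in\mathcal M^{\cdot\cdot}(X)$, $$B(\mu,\,\cdot\,)=\mathsf D_{\frac{z}{1+z},\,\rho+\mu}.$$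
   Context: $X$ is a Polish space, $\mathcal B_0$ the ring of bounded Borel sets of $X$ (for a fixed complete metric). $\mathcal M(X)$ is the space of locally finite measures on $X$ (finite on every $B\in\mathcal B_0$) and $\mathcal M^{\cdot\cdot}(X)$ the subset of locally finite point measures (non-negative integer-valued, multiple points allowed), both with the $\sigma$-algebra generated by the maps $\mu\mapsto\mu(B)$, $B\in\mathcal B_0$. A random measure is a probability measure on $\mathcal M(X)$; it is a point process if concentrated on $\mathcal M^{\cdot\cdot}(X)$. $\mathbf P_\kappa$ denotes the Poisson process with intensity measure $\kappa\in\mathcal M(X)$. For $z\in(0,1)$ and $\rho\in\mathcal M(X)$, the Poisson-Gamma random measure $\mathsf D_{z,\rho}$ is the infinitely divisible random measure on $X$ whose Lévy measure is the image of $\rho\otimes\tau_z$ under $(x,r)\mapsto r\delta_x$, where $\tau_z(\mathrm dr)=\frac1r e^{-\frac{1-z}{z}r}\,\mathrm dr$ on $(0,\infty)$; equivalently, its Laplace transform is $\int e^{-\kappa(h)}\,\mathsf D_{z,\rho}(\mathrm d\kappa)=\exp\left[-\iint(1-e^{-rh(x)})\,\tau_z(\mathrm dr)\,\rho(\mathrm dx)\right]$ for bounded non-negative measurable $h$. The Pólya sum process $\mathsf S_{z,\rho}$ is the unique point process $\mathsf P$ on $X$ satisfying $\iint h(x,\mu)\,\mu(\mathrm dx)\,\mathsf P(\mathrm d\mu)=z\iint h(x,\mu+\delta_x)\,(\rho+\mu)(\mathrm dx)\,\mathsf P(\mathrm d\mu)$ for all bounded non-negative measurable $h$ on $X\times\mathcal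 M^{\cdot\cdot}(X)$. It is known that $\mathsf S_{z,\rho}=\int\mathbf P_\kappa\,\mathsf D_{z,\rho}(\mathrm d\kappa)$. The Bayes kernel is determined up to $\mathsf S_{z,\rho}$-null sets of $\mu$. *)

(* Defs.v *)
From HB Require Import structures.
From mathcomp Require Import all_boot all_order all_algebra.
From mathcomp Require Import all_classical all_reals all_analysis.
From mathcomp Require Import measurable_realfun.

Set Implicit Arguments.
Unset Strict Implicit.
Unset Printing Implicit Defensive.

Import Order.TTheory GRing.Theory Num.Theory.
Import numFieldTopology.Exports numFieldNormedType.Exports.

Local Open Scope classical_set_scope.
Local Open Scope ring_scope.

HB.mixin Record isSeparable T & Topological T := {
  separable_dense : exists2 A : set T, countable A & dense A
}.

(* A Polish space together with the complete metric that fixes which sets are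
   bounded. [Complete] makes the type pointed, so the space is nonempty. *)
#[short(type="polishMetricType")]
HB.structure Definition PolishMetric (R : realType) :=
  {T of Metric R T & Complete T & isSeparable T}.

Definition borel {R : realType} (X : polishMetricType R) :=
  g_sigma_algebraType (@open X).

HB.instance Definition _ (R : realType) (X : polishMetricType R) :=
  Measurable.on (borel X).

Section measure_spaces.
Local Open Scope ereal_scope.
Context {R : realType} (X : polishMetricType R).

Definition bounded_borel (A : set (borel X)) : Prop :=
  measurable A /\ exists (x : X) (r : R), (A : set X) `<=` ball x r.

(* As for every measure of the library, values on non-measurable sets are
   irrelevant junk; the sigma-algebras below do not see them. *)
Record lfMeasure := LfMeasure {
  lf_measure :> {measure set (borel X) -> \bar R} ;
  lf_bounded : forall A, bounded_borel A -> lf_measure A < +oo }.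

Record pointMeasure := PointMeasure {
  pm_lfMeasure :> lfMeasure ;
  pm_integer : forall A, bounded_borel A ->
    exists n : nat, pm_lfMeasure A = n%:R%:E }.

Let mzero_bounded A : bounded_borel A -> @mzero _ (borel X) R A < +oo.
Proof. by rewrite /mzero. Qed.

Definition lf_zero : lfMeasure := LfMeasure mzero_bounded.

Let lf_zero_integer A : bounded_borel A -> exists n : nat, lf_zero A = n%:R%:E.
Proof. by exists 0%N. Qed.

Definition pm_zero : pointMeasure := PointMeasure lf_zero_integer.

HB.instance Definition _ := gen_eqMixin lfMeasure.
HB.instance Definition _ := gen_choiceMixin lfMeasure.
HB.instance Definition _ := isPointed.Build lfMeasure lf_zero.

HB.instance Definition _ := gen_eqMixin pointMeasure.
HB.instance Definition _ := gen_choiceMixin pointMeasure.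
HB.instance Definition _ := isPointed.Build pointMeasure pm_zero.

Definition lf_evaluations : set (set lfMeasure) :=
  \bigcup_(A in bounded_borel)
    preimage_set_system setT (fun mu : lfMeasure => mu A) measurable.

Definition pm_evaluations : set (set pointMeasure) :=
  \bigcup_(A in bounded_borel)
    preimage_set_system setT (fun mu : pointMeasure => mu A) measurable.

Definition lf_display : measure_display. Proof. by constructor. Qed.
Definition pm_display : measure_display. Proof. by constructor. Qed.

HB.instance Definition _ := @isMeasurable.Build lf_display lfMeasure
  <<s lf_evaluations >> (@sigma_algebra0 _ setT _)
  (@sigma_algebraC _ _) (@sigma_algebra_bigcup _ setT _).

HB.instance Definition _ := @isMeasurable.Build pm_display pointMeasure
  <<s pm_evaluations >> (@sigma_algebra0 _ setT _)
  (@sigma_algebraC _ _) (@sigma_algebra_bigcup _ setT _).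

Let lf_add_bounded (mu nu : lfMeasure) A :
  bounded_borel A -> measure_add mu nu A < +oo.
Proof.
by move=> bA; rewrite measure_addE lte_add_pinfty// lf_bounded.
Qed.

Definition lf_add (mu nu : lfMeasure) : lfMeasure :=
  LfMeasure (lf_add_bounded mu nu).

Let lf_scaled_dirac_bounded (r : R) (x : borel X) A :
  bounded_borel A -> mscale (`|r|%:nng)%R \d_x A < +oo.
Proof. by move=> _; rewrite /mscale/= diracE -EFinM ltry. Qed.

(* r \delta_x; only used for r > 0, the absolute value makes it total *)
Definition lf_scaled_dirac (xr : borel X * R) : lfMeasure :=
  LfMeasure (@lf_scaled_dirac_bounded xr.2 xr.1).

Let pm_add_dirac_integer (mu : pointMeasure) (x : borel X) A :
  bounded_borel A -> exists n : nat,
    lf_add mu (lf_scaled_dirac (x, 1%R)) A = n%:R%:E.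
Proof.
move=> bA; have [n muA] := pm_integer mu bA.
exists (n + (x \in A))%N.
transitivity (mu A + lf_scaled_dirac (x, 1%R) A); first exact: measure_addE.
by rewrite /= /mscale/= diracE normr1 mul1e muA natrD EFinD.
Qed.

(* mu + \delta_x *)
Definition pm_add_dirac (mu : pointMeasure) (x : borel X) : pointMeasure :=
  PointMeasure (@pm_add_dirac_integer mu x).

End measure_spaces.

Section gamma_levy_measure.
Local Open Scope ereal_scope.
Context {R : realType} (z : R).

Definition tau_density : R -> R :=
  (fun r : R => r^-1 * expR (- ((1 - z) / z) * r))%R \_ `]0%R, +oo[.

Definition tau (A : set R) : \bar R :=
  \int[lebesgue_measure]_(r in A) (tau_density r)%:E.

Lemma tau_density_ge0 r : (0 <= tau_density r)%R.
Proof.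
apply: restrict_ge0 => {}r /=; rewrite in_itv/= andbT => r0.
by rewrite mulr_ge0 ?expR_ge0// invr_ge0 ltW.
Qed.

Lemma measurable_tau_density : measurable_fun [set: R] tau_density.
Proof.
apply/measurable_restrict => //; rewrite setTI.
apply: open_continuous_measurable_fun.
  exact: (@interval_open R (BRight 0%R) (BInfty R false)).
move=> r; rewrite inE/= in_itv/= andbT => r0.
apply: (@continuousM _ R^o); first by apply: inv_continuous; rewrite gt_eqF.
apply: continuous_comp; last exact: continuous_expR.
by apply: (@continuousM _ R^o) => //; exact: cst_continuous.
Qed.

Let tau0 : tau set0 = 0.
Proof. by rewrite /tau integral_set0. Qed.

Let tau_ge0 A : 0 <= tau A.
Proof. by apply: integral_ge0 => r _; rewrite lee_fin tau_density_ge0. Qed.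

Let tau_sigma_additive : semi_sigma_additive tau.
Proof.
move=> /= F mF tF mUF; rewrite /tau; apply: cvg_toP.
  apply: ereal_nondecreasing_is_cvgn => m n mn.
  apply: lee_sum_nneg_natr => // k _ _; apply: integral_ge0 => /= x Fkx.
  by rewrite lee_fin tau_density_ge0.
rewrite ge0_integral_bigcup//=.
- apply/measurable_funTS/measurableT_comp => //.
  exact: measurable_tau_density.
- by move=> x _; rewrite lee_fin tau_density_ge0.
Qed.

HB.instance Definition _ := isMeasure.Build _ _ _ tau
  tau0 tau_ge0 tau_sigma_additive.

Lemma tau_itvNyc : tau `]-oo, 0%R] = 0.
Proof.
apply: integral0_eq => r /=; rewrite in_itv/= => r0.
by rewrite /tau_density patchE ifF// memNset//= in_itv/= andbT ltNge r0.
Qed.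

Let cpt (n : nat) : set R := [set` `[n.+1%:R^-1, n.+1%:R]%R].

Let tau_sigma_finite : sigma_finite setT tau.
Proof.
exists (fun n => `]-oo, 0%R] `|` cpt n).
  apply/esym; rewrite -subTset => r _.
  have [r0|r0] := leP r 0%R; first by exists 0%N => //; left; rewrite /= in_itv.
  exists (maxn (Num.truncn r) (Num.truncn r^-1)) => //; right.
  rewrite /cpt/= in_itv/=; apply/andP; split.
    rewrite -[leRHS]invrK lef_pV2 ?posrE ?invr_gt0//.
    by rewrite (le_trans (ltW (truncnS_gt _)))// ler_nat ltnS leq_maxr.
  by rewrite (le_trans (ltW (truncnS_gt _)))// ler_nat ltnS leq_maxl.
move=> n; split.
  by apply: measurableU; rewrite ?/cpt; exact: measurable_itv.
apply: (@le_lt_trans _ _ (tau `]-oo, 0%R] + tau (cpt n))).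
  by apply: measureU2; rewrite ?/cpt; exact: measurable_itv.
rewrite tau_itvNyc add0e.
pose c := (n.+1%:R * expR (`|(1 - z) / z| * n.+1%:R))%R.
apply: (@le_lt_trans _ _ (\int[lebesgue_measure]_(r in cpt n) c%:E)).
  apply: ge0_le_integral => //=; rewrite ?/cpt//.
  - by move=> r _; rewrite lee_fin tau_density_ge0.
  - apply/measurable_funTS/measurableT_comp => //.
    exact: measurable_tau_density.
  move=> r; rewrite /cpt/= in_itv/= => /andP[nr rn].
  have r0 : (0 < r)%R by rewrite (lt_le_trans _ nr).
  rewrite lee_fin /tau_density patchE /c ifT ?inE/= ?in_itv/= ?r0//.
  rewrite ler_pM ?invr_ge0 ?expR_ge0 ?(ltW r0)//.
    by rewrite -[leRHS]invrK lef_pV2 ?posrE ?invr_gt0.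
  rewrite ler_expR (le_trans (ler_norm _))// normrM normrN.
  by rewrite ler_wpM2l// gtr0_norm.
rewrite /cpt /c integral_cst//= lte_mul_pinfty ?lee_fin ?mulr_ge0 ?expR_ge0//.
by rewrite lebesgue_measure_itv/=; case: ifP => _; rewrite -?EFinB ltry.
Qed.

HB.instance Definition _ :=
  @Measure_isSigmaFinite.Build _ _ _ tau tau_sigma_finite.

End gamma_levy_measure.

Section random_measures.
Local Open Scope ereal_scope.
Context {R : realType} {X : polishMetricType R}.

(* \int e^{-kappa(h)} D(dkappa); the integral kappa(h) may be infinite. *)
Definition laplace (D : {measure set (lfMeasure X) -> \bar R})
    (h : borel X -> R) : \bar R :=
  \int[D]_kappa expeR (- \int[kappa]_x (h x)%:E).

Definition bounded_nonneg_measurable d (T : measurableType d) (h : T -> R) :=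
  [/\ measurable_fun setT h, (forall x, 0 <= h x)%R
    & exists M : R, forall x, (h x <= M)%R].

(* The Levy-Khintchine formula without deterministic part. It determines the law
   D; taking h = 0 shows that D is a probability measure. *)
Definition infinitely_divisible_with_levy
    (Lambda : set (lfMeasure X) -> \bar R)
    (D : {measure set (lfMeasure X) -> \bar R}) : Prop :=
  forall h : borel X -> R, bounded_nonneg_measurable h ->
    laplace D h =
    expeR (- \int[Lambda]_nu (1 - expeR (- \int[nu]_x (h x)%:E))).

Definition gamma_levy (z : R) (rho : lfMeasure X) :
    set (lfMeasure X) -> \bar R :=
  pushforward (rho \x tau z) (@lf_scaled_dirac R X).

Definition is_poisson_gamma (z : R) (rho : lfMeasure X)
    (D : {measure set (lfMeasure X) -> \bar R}) : Prop :=
  infinitely_divisible_with_levy (gamma_levy z rho) D.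

(* The joint law of the counts on disjoint bounded Borel sets is the product of
   Poisson laws. The second argument of [poisson_prob] is not used by the
   library. *)
Definition is_poisson_process (kappa : lfMeasure X)
    (P : {measure set (pointMeasure X) -> \bar R}) : Prop :=
  forall (n : nat) (A : 'I_n -> set (borel X)) (k : 'I_n -> nat),
    (forall i, bounded_borel (A i)) -> trivIset setT A ->
    P [set mu | forall i, mu (A i) = (k i)%:R%:E] =
    \prod_(i < n) poisson_prob (fine (kappa (A i))) 0 [set k i].

Definition is_polya_sum (z : R) (rho : lfMeasure X)
    (P : {measure set (pointMeasure X) -> \bar R}) : Prop :=
  forall h : borel X * pointMeasure X -> R, bounded_nonneg_measurable h ->
    \int[P]_mu \int[mu]_x (h (x, mu))%:E =
    z%:E * \int[P]_mu \int[lf_add rho mu]_x (h (x, pm_add_dirac mu x))%:E.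

(* B is a Bayes kernel for the prior D and the likelihood kappa |-> P kappa,
   with marginal S *)
Definition is_bayes_kernel
    (P : lfMeasure X -> probability (pointMeasure X) R)
    (D : probability (lfMeasure X) R) (S : probability (pointMeasure X) R)
    (B : R.-pker (pointMeasure X) ~> (lfMeasure X)) : Prop :=
  forall f : pointMeasure X * lfMeasure X -> \bar R,
    measurable_fun setT f -> (forall p, 0 <= f p) ->
    \int[D]_kappa \int[P kappa]_mu f (mu, kappa) =
    \int[S]_mu \int[B mu]_kappa f (mu, kappa).

End random_measures.

Section laplace_form.
Local Open Scope ereal_scope.
Context {R : realType} {X : polishMetricType R}.

Lemma measurable_expeR : measurable_fun [set: \bar R] (@expeR R).
Proof.
have -> : @expeR R = fun x => if x == +oo then +oo else
    if x == -oo then 0 else (expR (fine x))%:E.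
  by apply/funext => -[].
apply: measurable_fun_ifT => //=; first exact: measurable_fun_eqe.
apply: measurable_fun_ifT => //=; first exact: measurable_fun_eqe.
apply/measurable_EFinP => //=.
by apply: measurableT_comp => //; exact: measurable_expR.
Qed.

Lemma metric_ball_open (x : X) (r : R) : open (ball x r).
Proof.
rewrite openE => y; rewrite ballEmdist /= => xyr.
have d0 : (0 < r - mdist x y)%R by rewrite subr_gt0.
apply: filterS (nbhsx_ballx y _ d0) => w; rewrite ballEmdist/= => ywr.
rewrite (le_lt_trans (metric_triangle x y w))//.
by rewrite -ltrBrDl.
Qed.

Let Ball (n : nat) : set (borel X) := ball (point : X) n%:R.

Let bounded_Ball n : bounded_borel (Ball n).
Proof.
split; last by exists point, n%:R.
by apply: sub_sigma_algebra; exact: metric_ball_open.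
Qed.

Let nd_Ball : nondecreasing_seq Ball.
Proof.
move=> m n mn; apply/subsetPset; rewrite /Ball.
by apply: le_ball; rewrite ler_nat.
Qed.

Let bigcup_Ball : \bigcup_n Ball n = setT.
Proof.
rewrite -subTset => x _; exists (Num.truncn (mdist (point : X) x)).+1 => //.
by rewrite /Ball ballEmdist/= truncnS_gt.
Qed.

Lemma lf_sigma_finite (mu : lfMeasure X) : sigma_finite setT mu.
Proof.
exists Ball; first by rewrite bigcup_Ball.
by move=> n; have bB := bounded_Ball n; split; [case: bB|exact: lf_bounded].
Qed.

(* An alias that carries the sigma-finiteness instance. *)
Definition lf_fun (mu : lfMeasure X) : set (borel X) -> \bar R := mu.

HB.instance Definition _ mu := Measure.copy (lf_fun mu) (lf_measure mu).

HB.instance Definition _ mu :=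
  @Measure_isSigmaFinite.Build _ _ _ (lf_fun mu) (lf_sigma_finite mu).

Let measurable_lf_eval_bounded A : bounded_borel A ->
  measurable_fun [set: lfMeasure X] (fun mu => mu A).
Proof.
move=> bA _ B mB; apply: sub_sigma_algebra.
by exists A => //; exists B.
Qed.

Lemma measurable_lf_eval A : measurable A ->
  measurable_fun [set: lfMeasure X] (fun mu => mu A).
Proof.
move=> mA; have mAB n : measurable (A `&` Ball n).
  by apply: measurableI => //; case: (bounded_Ball n).
apply: (@emeasurable_fun_cvg _ _ _ _
    (fun n (mu : lfMeasure X) => mu (A `&` Ball n))).
  move=> n; apply: measurable_lf_eval_bounded; split => //.
  by exists point, n%:R => x [].
move=> mu _; rewrite -[in X in _ --> X](setIT A) -bigcup_Ball setI_bigcupr.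
apply: nondecreasing_cvg_mu => //; first exact: bigcupT_measurable.
move=> m n mn; apply/subsetPset; apply: setIS; apply/subsetPset.
exact: nd_Ball.
Qed.

Import HBNNSimple.

Lemma measurable_lf_integral (f : borel X -> \bar R) :
  measurable_fun setT f -> (forall x, 0 <= f x) ->
  measurable_fun [set: lfMeasure X] (fun mu => \int[mu]_x f x).
Proof.
move=> mf f0; pose g := nnsfun_approx measurableT mf.
apply: (@emeasurable_fun_cvg _ _ _ _
    (fun n (mu : lfMeasure X) => \int[mu]_x (g n x)%:E)).
  move=> n; under eq_fun do rewrite integralT_nnsfun sintegralE.
  apply: emeasurable_fsum => // r.
  by apply: measurable_funeM; exact: measurable_lf_eval.
move=> mu _; rewrite (_ : \int[mu]_x f x = \int[mu]_x limn (fun n => (g n x)%:E)).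
  apply: cvg_monotone_convergence => //.
  - by move=> n; exact/measurable_EFinP.
  - by move=> n x _; rewrite lee_fin.
  - by move=> t _ n m nm; rewrite lee_fin; exact/lefP/nd_nnsfun_approx.
apply: eq_integral => t _.
by apply/esym/cvg_lim => //; exact/cvg_nnsfun_approx.
Qed.

Lemma measurable_lf_scaled_dirac :
  measurable_fun [set: borel X * R] (@lf_scaled_dirac R X).
Proof.
apply: (measurability (@lf_evaluations R X)) => //.
move=> _ [_ [A [mA _] [B mB <-]] <-].
rewrite !setTI -comp_preimage.
rewrite -[X in measurable X]setTI; move: mB.
suff : measurable_fun setT
  (fun xr : borel X * R => (lf_scaled_dirac xr : lfMeasure X) A).
  by move=> h mB; exact: h.
rewrite (_ : (fun _ => _) =
    fun xr : borel X * R => (`|xr.2| * \1_A xr.1)%:E); last first.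
  by apply/funext => -[x r]; rewrite /= /mscale/= /dirac -EFinM.
apply/measurable_EFinP; apply: measurable_funM.
  by apply: measurableT_comp => //; exact: measurable_snd.
by apply: measurableT_comp => //; exact: measurable_fst.
Qed.


Lemma lf_scaled_dirac_integral (r : R) (x : borel X) (h : borel X -> R) :
  measurable_fun setT h -> (forall y, 0 <= h y)%R ->
  \int[lf_scaled_dirac (x, r)]_y (h y)%:E = (`|r| * h x)%:E.
Proof.
move=> mh h0; have mEh : measurable_fun setT (EFin \o h).
  exact/measurable_EFinP.
rewrite /= (@ge0_integral_mscale _ _ _ _ setT)//=; last first.
  by move=> y _; rewrite lee_fin.
by rewrite integral_dirac//= diracT mul1e EFinM.
Qed.

Lemma gamma_levy_integral (z : R) (rho : lfMeasure X) (h : borel X -> R) :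
  bounded_nonneg_measurable h ->
  \int[gamma_levy z rho]_nu (1 - expeR (- \int[nu]_x (h x)%:E)) =
  \int[rho]_x \int[tau z]_(r in `]0%R, +oo[) (1 - expR (- (r * h x)))%:E.
Proof.
move=> [mh h0 _].
pose g (xr : borel X * R) : \bar R := (1 - expR (- (`|xr.2| * h xr.1)))%:E.
have mg : measurable_fun setT g.
  apply/measurable_EFinP; apply: measurable_funB => //.
  apply: measurableT_comp; first exact: measurable_expR.
  apply: measurableT_comp => //; apply: measurable_funM.
    by apply: measurableT_comp => //; exact: measurable_snd.
  by apply: measurableT_comp => //; exact: measurable_fst.
have g0 xr : 0 <= g xr.
  by rewrite lee_fin subr_ge0 -expR0 ler_expR oppr_le0 mulr_ge0.
rewrite /gamma_levy.
transitivity (\int[lf_fun rho \x tau z]_xr g xr).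
  have mint : measurable_fun setT
      (fun nu : lfMeasure X => 1 - expeR (- \int[nu]_x (h x)%:E)).
    apply: emeasurable_funB => //; apply: (measurableT_comp measurable_expeR).
    apply: measurableT_comp => //; apply: measurable_lf_integral.
      exact/measurable_EFinP.
    by move=> x; rewrite lee_fin.
  rewrite (ge0_integral_pushforward measurable_lf_scaled_dirac (lf_fun rho \x tau z))//.
    rewrite preimage_setT; apply: eq_integral => -[x r] _ /=.
    by rewrite lf_scaled_dirac_integral.
  move=> nu _; rewrite sube_ge0 ?orbT//.
    rewrite -expeR0 lee_expeR oppe_le0.
    by apply: integral_ge0 => x _; rewrite lee_fin.
rewrite (@fubini_tonelli1 _ _ _ _ _ (lf_fun rho) (tau z) g mg g0); apply: eq_integral => x _; rewrite /fubini_F.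
rewrite (@ge0_negligible_integral _ _ _ _ setT (`]-oo, 0%R] : set R))//; last 2 first.
  by apply: measurableT_comp mg _; exact: measurable_pair1.
  exact: tau_itvNyc.
rewrite setTD setCitvl; apply: eq_integral => r.
by rewrite inE/= in_itv/= andbT => r0; rewrite /g/= gtr0_norm.
Qed.

(* The explicit form of the Laplace transform of the Poisson-Gamma random
   measure. *)
Lemma is_poisson_gammaE (z : R) (rho : lfMeasure X)
    (D : {measure set (lfMeasure X) -> \bar R}) :
  is_poisson_gamma z rho D <->
  forall h : borel X -> R, bounded_nonneg_measurable h ->
    laplace D h = expeR (- \int[rho]_x \int[tau z]_(r in `]0%R, +oo[)
      (1 - expR (- (r * h x)))%:E).
Proof.
by split=> H h bh; have := H h bh; rewrite (gamma_levy_integral z rho bh).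
Qed.

End laplace_form.

(* Main.v *)
Require Import Defs.
From HB Require Import structures.
From mathcomp Require Import all_boot all_order all_algebra.
From mathcomp Require Import all_classical all_reals all_analysis.
From mathcomp Require Import measurable_realfun.
From mathcomp Require Import ring.

(** Write kappa(h) for the integral of h against kappa, and w = z / (1 - z).
The joint law of (mu, kappa) under the Bayesian model is tested on the products
e^{-mu(g)} e^{-kappa(h)}, for bounded nonnegative measurable g and h.

The exponent of the Poisson-Gamma law is a Frullani integral
([gamma_exponent]): the Laplace transform of D_{z,rho} at h is
exp(-rho(ln(1 + w h))), while a Poisson process satisfies
int e^{-mu(g)} dP_kappa = e^{-kappa(1 - e^{-g})} ([poisson_laplace]).  The joint
Laplace transform of (mu, kappa) is therefore
exp(-rho(ln(1 + w (h + 1 - e^{-g})))), and conjugacy is the factorisation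
  1 + w (h + 1 - e^{-g}) = (1 + z h) (1 + w (1 - e^{-g} / (1 + z h))),
which holds because 1 + w = 1 / (1 - z).  The second factor is the transform of
the marginal law S of mu at g + ln(1 + z h), so the joint transform is also
  int e^{-mu(g)} exp(-(rho + mu)(ln(1 + z h))) S(dmu)
([bayes_laplace]).  Since z' / (1 - z') = z for z' = z / (1 + z), the factor
exp(-(rho + mu)(ln(1 + z h))) is the Laplace transform of D_{z',rho+mu} at h.

For fixed h, the functions e^{-mu(g)} separate finite measures on point
measures ([ae_eq_nexp]): they determine the joint distribution of the counts
mu(A_1), ..., mu(A_n) through a power series in e^{-t}, and events on counts
form a pi-system.  Hence B(mu, .) has the right Laplace transform at h for
S-almost every mu, with an exceptional set depending on h.

A single exceptional set is obtained from a countable family of functions h: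
on each ball about a base point, the smallest family containing the indicators
of a countable base and stable under |f - g| and q f + g, with q a nonnegative
rational ([lattice_eval]).  Its closure under dominated pointwise limits
contains every bounded measurable function supported in the ball
([bounded_limit_measurable]), and for a fixed mu both sides of the required
equality are continuous along such limits ([gamma_laplace_determined]).  This
extension argument works on functions and so does not presuppose that a law
with the Laplace transform of D_{z',rho+mu} exists. *)

Set Implicit Arguments.
Unset Strict Implicit.
Unset Printing Implicit Defensive.

Import Order.TTheory GRing.Theory Num.Theory.
Import numFieldTopology.Exports numFieldNormedType.Exports.

Local Open Scope classical_set_scope.
Local Open Scope ring_scope.

(** * Exponentials of integrals *)

Section extended_exponential.
Local Open Scope ereal_scope.
Context {R : realType}.

(** The case of an infinite limit matters: integrals of bounded functions
against locally finite measures may be infinite, and the exponential is then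
zero. *)
Lemma cvg_expeRN (u : (\bar R)^nat) (l : \bar R) : (forall n, 0 <= u n) ->
  u @ \oo --> l -> expeR (- u n) @[n --> \oo] --> expeR (- l).
Proof.
move=> u0 ul.
have l0 : 0 <= l by apply: (cvge_ge _ ul) => //; exact: nearW.
case: l l0 ul => [l l0 ul|_ ul|//].
  have [fu cu] := (fine_cvgP _ _).1 ul.
  apply/fine_cvgP; split.
    by apply: filterS fu => n; case: (u n).
  apply: (@cvg_trans _ (expR (- fine (u n)) @[n --> \oo])%R).
    by apply: near_eq_cvg; apply: filterS fu => n /=; case: (u n) => [r _| |]//.
  apply: continuous_cvg; first exact: continuous_expR.
  exact: cvgN.
apply/fine_cvgP; split.
  by apply: nearW => n; case: (u n) (u0 n).
apply/cvgrPdist_le => e e0.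
move/cvgeyPge: ul => /(_ (- ln e)%R); apply: filterS => n.
rewrite /= sub0r normrN; case: (u n) => [r|_|//] /=.
  rewrite lee_fin => h; rewrite ger0_norm ?expR_ge0//.
  by rewrite -[leRHS]lnK ?posrE// ler_expR lerNl.
by rewrite normr0 ltW.
Qed.

Lemma expeRN_le1 (x : \bar R) : 0 <= x -> expeR (- x) <= 1.
Proof. by move=> x0; rewrite -expeR0 lee_expeR oppe_le0. Qed.

Lemma cvg_integral_le1 d (T : measurableType d)
    (mu : {measure set T -> \bar R}) (f : (T -> \bar R)^nat) (g : T -> \bar R) :
  mu setT < +oo ->
  (forall n, measurable_fun setT (f n)) -> measurable_fun setT g ->
  (forall n x, 0 <= f n x <= 1) -> (forall x, f ^~ x @ \oo --> g x) ->
  \int[mu]_x f n x @[n --> \oo] --> \int[mu]_x g x.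
Proof.
move=> muT mf mg f01 fg.
have [] := @dominated_convergence _ _ _ mu setT measurableT f g (cst 1) mf mg.
- by apply: aeW => x _; exact: fg.
- apply/integrableP; split; first exact: measurable_cst.
  under eq_integral do rewrite /= normr1.
  by rewrite integral_cst// mul1e.
- by apply: aeW => x n _; case/andP : (f01 n x) => f0 f1; rewrite gee0_abs.
- by move=> _ _.
Qed.

Lemma expeRND (a b : \bar R) : 0 <= a -> 0 <= b ->
  expeR (- (a + b)) = expeR (- a) * expeR (- b).
Proof.
move=> a0 b0; rewrite -expeRD.
by case: a b a0 b0 => [a| |] [b| |]//= _ _; rewrite opprD.
Qed.

(** The exponential test functions: laplace D h is the mean of
[kappa |-> nexp kappa h] under D. *)
Definition nexp d (T : measurableType d) (mu : set T -> \bar R) (g : T -> R)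
    : \bar R :=
  expeR (- \int[mu]_x (g x)%:E).

End extended_exponential.

Section nexp.
Local Open Scope ereal_scope.
Context {R : realType} d (T : measurableType d).
Variable mu : {measure set T -> \bar R}.

Let int_ge0 (g : T -> R) : (forall x, 0 <= g x)%R -> 0 <= \int[mu]_x (g x)%:E.
Proof. by move=> g0; apply: integral_ge0 => x _; rewrite lee_fin. Qed.

Implicit Types f g : T -> R.

Lemma nexp_ge0 g : 0 <= nexp mu g.
Proof. exact: expeR_ge0. Qed.

Lemma nexp_le1 g : (forall x, 0 <= g x)%R -> nexp mu g <= 1.
Proof. by move=> g0; apply/expeRN_le1/int_ge0. Qed.

Lemma nexpD f g : measurable_fun setT f -> measurable_fun setT g ->
  (forall x, 0 <= f x)%R -> (forall x, 0 <= g x)%R ->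
  nexp mu (fun x => f x + g x)%R = nexp mu f * nexp mu g.
Proof.
move=> mf mg f0 g0; rewrite /nexp -expeRND ?int_ge0//.
under eq_integral do rewrite EFinD.
by rewrite ge0_integralD//;
  [move=> x _; rewrite lee_fin|exact/measurable_EFinP
  |move=> x _; rewrite lee_fin|exact/measurable_EFinP].
Qed.

Lemma cvg_nexp_monotone (f : (T -> R)^nat) (g : T -> R) :
  (forall n, measurable_fun setT (f n)) ->
  (forall n x, 0 <= f n x)%R -> (forall x, nondecreasing_seq (f ^~ x)) ->
  (forall x, f ^~ x @ \oo --> g x) ->
  nexp mu (f n) @[n --> \oo] --> nexp mu g.
Proof.
move=> mf f0 ndf fg; apply: cvg_expeRN => [n|]; first exact: int_ge0.
rewrite (_ : \int[mu]_x (g x)%:E =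
    \int[mu]_x limn (fun n => (f n x)%:E)); last first.
  apply: eq_integral => x _; apply/esym/cvg_lim => //.
  by apply: cvg_EFin; [exact: nearW|exact: fg].
apply: (cvg_monotone_convergence (mu := mu) measurableT).
- by move=> n; exact/measurable_EFinP.
- by move=> n x _; rewrite lee_fin.
- by move=> x _ m n mn; rewrite lee_fin; exact: ndf.
Qed.

Lemma cvg_nexp_dominated (f : (T -> R)^nat) (g : T -> R) (W : set T) (M : R) :
  measurable W -> mu W < +oo ->
  (forall n, measurable_fun setT (f n)) ->
  (forall n x, 0 <= f n x <= M * \1_W x)%R ->
  (forall x, f ^~ x @ \oo --> g x) ->
  nexp mu (f n) @[n --> \oo] --> nexp mu g.
Proof.
move=> mW Wfin mf fM fg; apply: cvg_expeRN => [n|].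
  by apply: int_ge0 => x; case/andP: (fM n x).
have mg : measurable_fun setT g.
  by apply: measurable_fun_cvg mf _ => x _; exact: fg.
have [] := @dominated_convergence _ _ _ mu setT measurableT
    (fun n x => (f n x)%:E) (fun x => (g x)%:E) (fun x => (M * \1_W x)%:E).
- by move=> n; exact/measurable_EFinP.
- exact/measurable_EFinP.
- by apply: aeW => x _; apply: cvg_EFin; [exact: nearW|exact: fg].
- under eq_fun do rewrite EFinM.
  apply: integrableZl => //; apply/integrableP; split.
    exact/measurable_EFinP.
  under eq_integral do rewrite gee0_abs ?lee_fin//.
  by rewrite integral_indic// setIT.
- apply: aeW => x n _; case/andP: (fM n x) => f0 fM'.
  by rewrite gee0_abs ?lee_fin.
- by move=> _ _.
Qed.

End nexp.

Section nexp_random_measures.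
Local Open Scope ereal_scope.
Context {R : realType} {X : polishMetricType R}.

Lemma nexp_lf_add (m1 m2 : lfMeasure X) (g : borel X -> R) :
  measurable_fun setT g -> (forall x, 0 <= g x)%R ->
  nexp (lf_add m1 m2) g = nexp m1 g * nexp m2 g.
Proof.
move=> mg g0; rewrite /nexp -expeRND; last 2 first.
- by apply: integral_ge0 => x _; rewrite lee_fin.
- by apply: integral_ge0 => x _; rewrite lee_fin.
congr (expeR (- _)); apply: ge0_integral_measure_add => //.
- by move=> x _; rewrite lee_fin.
- exact/measurable_EFinP.
Qed.

Lemma measurable_nexp_lf (g : borel X -> R) :
  measurable_fun setT g -> (forall x, 0 <= g x)%R ->
  measurable_fun [set: lfMeasure X] (fun kappa => nexp kappa g).
Proof.
move=> mg g0; apply: (measurableT_comp measurable_expeR).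
apply: measurableT_comp => //; apply: measurable_lf_integral.
  exact/measurable_EFinP.
by move=> x; rewrite lee_fin.
Qed.

Lemma measurable_pm_lfMeasure :
  measurable_fun [set: pointMeasure X] (@pm_lfMeasure R X).
Proof.
apply: (measurability (@lf_evaluations R X)) => //.
move=> _ [_ [A bA [B mB <-]] <-]; rewrite !setTI.
apply: sub_sigma_algebra; exists A => //; exists B => //.
by rewrite setTI.
Qed.

Lemma measurable_pm_eval (A : set (borel X)) : measurable A ->
  measurable_fun [set: pointMeasure X] (fun mu : pointMeasure X => mu A).
Proof.
move=> mA; apply: (measurableT_comp (measurable_lf_eval mA)).
exact: measurable_pm_lfMeasure.
Qed.

Lemma measurable_nexp_pm (g : borel X -> R) :
  measurable_fun setT g -> (forall x, 0 <= g x)%R ->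
  measurable_fun [set: pointMeasure X] (fun mu => nexp mu g).
Proof.
move=> mg g0; apply: (measurableT_comp (measurable_nexp_lf mg g0)).
exact: measurable_pm_lfMeasure.
Qed.

End nexp_random_measures.

(** * Products of independent integer-valued variables *)

Lemma emeasurable_prod_ord d (T : measurableType d) (R : realType)
    (f : nat -> T -> \bar R) n : (forall i, measurable_fun setT (f i)) ->
  measurable_fun setT (fun x => \prod_(i < n) f i x)%E.
Proof.
move=> mf; elim: n => [|n IH].
  by apply: eq_measurable_fun (measurable_cst 1%E) => x _; rewrite big_ord0.
apply: eq_measurable_fun (emeasurable_funM IH (mf n)) => x _.
by rewrite big_ord_recr.
Qed.

(** The joint law of the counts is only known on the events fixing all the
counts at once.  The integral of a product is computed by releasing the counts
one after the other: an event that fixes the counts of index at least m.+1 is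
the disjoint union, over the value j of the count of index m, of events that fix
the counts of index at least m. *)
Section independent_counts.
Local Open Scope ereal_scope.
Context {R : realType} d (T : measurableType d).
Variables (P : {measure set T -> \bar R}) (N : nat -> T -> \bar R).
Variables (n : nat) (p : nat -> nat -> R).
Hypothesis mN : forall i, measurable_fun setT (N i).
Hypothesis N_nat : forall i x, exists k : nat, N i x = k%:R%:E.
Hypothesis p0 : forall i k, (0 <= p i k)%R.
Hypothesis indepN : forall k : nat -> nat,
  P [set x | forall i, (i < n)%N -> N i x = (k i)%:R%:E] =
  \prod_(i < n) (p i (k i))%:E.
Variable phi : nat -> \bar R -> \bar R.
Hypothesis phi0 : forall i y, 0 <= phi i y.
Hypothesis mphi : forall i, measurable_fun setT (phi i).

Variable a : nat -> R.
Hypothesis sum_phi : forall i,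
  \sum_(j <oo) phi i j%:R%:E * (p i j)%:E = (a i)%:E.

Let level m (k : nat -> nat) :=
  [set x | forall i, (m <= i < n)%N -> N i x = (k i)%:R%:E].

Let mlevel m k : measurable (level m k).
Proof.
rewrite (_ : level m k =
    \bigcap_(i in [set i | (m <= i < n)%N]) (N i @^-1` [set (k i)%:R%:E]))//.
apply: bigcap_measurableType => i _.
rewrite -[X in measurable X]setTI; exact: mN.
Qed.

Let integral_level m (k : nat -> nat) : (m <= n)%N ->
  \int[P]_(x in level m k) \prod_(i < m) phi i (N i x) =
  (\prod_(i < m) a i)%:E * \prod_(m <= i < n) (p i (k i))%:E.
Proof.
elim: m k => [|m IH] k mn.
  rewrite big_ord0 mul1e; under eq_integral do rewrite big_ord0.
  by rewrite integral_cst// mul1e indepN big_mkord.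
pose kj (j : nat) : nat -> nat := fun i => if i == m then j else k i.
have -> : level m.+1 k = \bigcup_j level m (kj j).
  apply/seteqP; split => x.
    move=> xk; have [j Nj] := N_nat m x; exists j => // i /andP[mi iN].
    rewrite /kj; case: eqVneq => [->//|im]; apply: xk.
    by rewrite iN andbT ltn_neqAle eq_sym im.
  move=> [j _ xj] i /andP[mi iN]; rewrite xj ?(ltnW mi)//.
  by rewrite /kj gtn_eqF.
have mprod q (D : set T) :
    measurable_fun D (fun x => \prod_(i < q) phi i (N i x)).
  apply: measurable_funTS.
  apply: (emeasurable_prod_ord (f := fun i x => phi i (N i x))) => i.
  exact: measurableT_comp.
have prod0 q x : 0 <= \prod_(i < q) phi i (N i x).
  by apply: prode_ge0.
rewrite ge0_integral_bigcup//; last first.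
  apply/trivIsetP => i j _ _ ij; apply/seteqP; split => // x [xi xj].
  move/eqP: ij; apply.
  have := xi m; have := xj m; rewrite leqnn mn /kj eqxx => -> // /(_ isT)[].
  by move/eqP; rewrite eqr_nat => /eqP.
pose c := (\prod_(i < m) a i * \prod_(m.+1 <= i < n) p i (k i))%R.
transitivity (\sum_(j <oo) c%:E * (phi m j%:R%:E * (p m j)%:E)).
  apply: eq_eseriesr => j _.
  transitivity (\int[P]_(x in level m (kj j))
      (phi m j%:R%:E * \prod_(i < m) phi i (N i x))).
    apply: eq_integral => x; rewrite inE => xj.
    rewrite big_ord_recr/= muleC; congr (phi m _ * _).
    by rewrite xj ?leqnn// /kj eqxx.
  rewrite ge0_integralZl//.
  rewrite IH ?(ltnW mn)// big_ltn// {1}/kj eqxx.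
  rewrite (_ : \prod_(m.+1 <= i < n) _ = \prod_(m.+1 <= i < n) (p i (k i))%:E).
    by rewrite prodEFin /c EFinM muleCA -muleA; congr (_ * _);
      rewrite muleA muleC.
  by apply: eq_big_nat => i /andP[mi _]; rewrite /kj gtn_eqF.
rewrite nneseriesZl; last by move=> j _; rewrite mule_ge0 ?lee_fin.
rewrite sum_phi prodEFin /c big_ord_recr/= !EFinM.
by rewrite -!muleA; congr (_ * _); rewrite muleC.
Qed.

Lemma integral_prod_independent_counts :
  \int[P]_x \prod_(i < n) phi i (N i x) =
  (\prod_(i < n) a i)%:E.
Proof.
have := @integral_level n (fun=> 0%N) (leqnn n).
rewrite big_geq// mule1 => <-; congr integral.
apply/seteqP; split => // x _ i /andP[ni]; by rewrite ltnNge ni.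
Qed.

End independent_counts.

(** * Poisson generating functions and step functions *)

Section poisson_generating_function.
Local Open Scope ereal_scope.
Context {R : realType}.
Implicit Types l c : R.

Lemma nneseries_expR l :
  \sum_(j <oo) (l ^+ j / j`!%:R)%:E = (expR l)%:E.
Proof.
rewrite /expR -EFin_lim; last exact: is_cvg_series_exp_coeff.
by congr (limn _); apply/funext => n; rewrite sumEFin.
Qed.

(** The formula holds for the rate 0 as well, where the law is a Dirac mass at
0 and the convention 0 ^+ 0 = 1 is used. *)
Lemma poisson_prob1 l k : (0 <= l)%R ->
  poisson_prob l 0 [set k] = (l ^+ k / k`!%:R * expR (- l))%:E.
Proof.
move=> l0; rewrite /poisson_prob; case: ifPn => [lpos|].
  by rewrite esum_set1 ?lee_fin ?poisson_pmf_ge0// /poisson_pmf lpos.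
rewrite -leNgt => le0; have -> : l = 0%R by apply/eqP; rewrite eq_le le0.
rewrite diracE oppr0 expR0 mulr1; case: k => [|k].
  by rewrite mem_set// expr0 fact0 divr1.
by rewrite memNset// expr0n mul0r.
Qed.

Lemma poisson_generating_function l c : (0 <= l)%R ->
  \sum_(j <oo) expeR (- (c%:E * j%:R%:E)) * (l ^+ j / j`!%:R * expR (- l))%:E
  = (expR (- (l * (1 - expR (- c)))))%:E.
Proof.
move=> l0.
transitivity (\sum_(j <oo)
    (expR (- l))%:E * ((l * expR (- c)) ^+ j / j`!%:R)%:E).
  apply: eq_eseriesr => j _; rewrite -(EFinM c) /= -!EFinM; congr EFin.
  by rewrite exprMn -expRM_natr mulNr; ring.
rewrite nneseriesZl => [|j _]; last first.
  by rewrite lee_fin divr_ge0 ?exprn_ge0 ?mulr_ge0 ?expR_ge0.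
rewrite nneseries_expR -EFinM -expRD; congr (expR _)%:E; ring.
Qed.

End poisson_generating_function.

Section step_functions.
Context {R : realType} {X : polishMetricType R}.
Implicit Types (g : borel X -> R) (mu : lfMeasure X).

(** The sets are bounded and pairwise disjoint, so that the joint law of their
counts under a Poisson process is the product of Poisson laws. *)
Definition step_function g :=
  exists n (A : nat -> set (borel X)) (c : nat -> R),
  [/\ forall i, bounded_borel (A i), trivIset setT A, forall i, 0 <= c i &
      forall x, g x = \sum_(i < n) c i * \1_(A i) x].

(** At each point at most one indicator does not vanish. *)
Lemma disjoint_step_comp (f : R -> R) n (A : nat -> set (borel X)) c x :
  f 0 = 0 -> trivIset setT A ->
  f (\sum_(i < n) c i * \1_(A i) x) = \sum_(i < n) f (c i) * \1_(A i) x.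
Proof.
move=> f0 tA; have [[j [jn Aj]]|nA] := pselect (exists j, (j < n)%N /\ A j x).
  have NA i : i != j -> \1_(A i) x = 0 :> R.
    move=> ij; rewrite indicE memNset// => Ai.
    by move/eqP: ij; apply; apply: (tA i j) => //; exists x.
  rewrite (bigD1 (Ordinal jn))//= big1 ?addr0; last first.
    by move=> i ij; rewrite NA ?mulr0//.
  rewrite [RHS](bigD1 (Ordinal jn))//= [X in _ + X]big1 ?addr0; last first.
    by move=> i ij; rewrite NA ?mulr0//.
  by rewrite indicE mem_set// !mulr1.
have NA i : (i < n)%N -> \1_(A i) x = 0 :> R.
  by move=> iN; rewrite indicE memNset// => Ai; apply: nA; exists i.
by rewrite !big1 ?f0// => i _; rewrite NA ?mulr0.
Qed.

Lemma nexp_step mu n (A : nat -> set (borel X)) (c : nat -> R) :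
  (forall i, bounded_borel (A i)) -> (forall i, 0 <= c i) ->
  nexp mu (fun x => \sum_(i < n) c i * \1_(A i) x) =
  (\prod_(i < n) expeR (- ((c i)%:E * mu (A i))))%E.
Proof.
move=> bA c0; rewrite /nexp.
under eq_integral do rewrite -sumEFin.
rewrite ge0_integral_sum//; last 2 first.
- move=> i; apply/measurable_EFinP; apply: measurable_funM => //.
  by apply: measurable_indic; case: (bA i).
- by move=> i x _; rewrite lee_fin mulr_ge0.
rewrite (eq_bigr (fun i : 'I_n => ((c i)%:E * mu (A i))%E)); last first.
  move=> i _; under eq_integral do rewrite EFinM.
  have mA : measurable (A i) by case: (bA i).
  rewrite ge0_integralZl//; last 2 first.
  - by apply/measurable_EFinP; apply: measurable_indic.
  - by rewrite lee_fin.
  by rewrite integral_indic// setIT.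
elim: n => [|n IH]; first by rewrite !big_ord0 oppe0 expeR0.
rewrite !big_ord_recr/= expeRND ?IH//.
  by apply: sume_ge0 => i _; rewrite mule_ge0// lee_fin.
by rewrite mule_ge0// lee_fin.
Qed.

End step_functions.

(** * The Laplace transform of a Poisson process *)

Section approximation.
Context {R : realType} {X : polishMetricType R}.
Implicit Types (g : borel X -> R) (mu : lfMeasure X).

(** These balls exhaust the space, and locally finite measures are finite on
each of them. *)
Definition point_ball (n : nat) : set (borel X) := ball (point : X) n%:R.

Lemma bounded_point_ball n : bounded_borel (point_ball n).
Proof.
split; last by exists point, n%:R.
by apply: sub_sigma_algebra; exact: metric_ball_open.
Qed.

Lemma point_ball_nondecreasing : nondecreasing_seq point_ball.
Proof. by move=> m n mn; apply/subsetPset/le_ball; rewrite ler_nat. Qed.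

Lemma in_point_ball_near (x : borel X) : \forall n \near \oo, point_ball n x.
Proof.
exists (Num.truncn (mdist (point : X) x)).+1 => //= n /=.
rewrite /point_ball ballEmdist/= -(@ler_nat R); apply: lt_le_trans.
exact: truncnS_gt.
Qed.

Lemma indic_point_ball_nondecreasing (x : borel X) :
  nondecreasing_seq (fun n => \1_(point_ball n) x : R).
Proof.
move=> m n mn; rewrite !indicE ler_nat;
  case: (boolP (x \in point_ball m)) => // xm.
rewrite mem_set//; move/set_mem: xm.
by have /subsetPset := point_ball_nondecreasing mn; exact.
Qed.

Lemma cvg_indic_point_ball (f : nat -> borel X -> R) g x :
  f ^~ x @ \oo --> g x -> f n x * \1_(point_ball n) x @[n --> \oo] --> g x.
Proof.
apply: cvg_trans; apply: near_eq_cvg.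
apply: filterS (in_point_ball_near x) => n xn.
by rewrite indicE mem_set// mulr1.
Qed.

Import HBNNSimple.

(** A simple function takes finitely many values, and its level sets, cut by W,
are disjoint and bounded. *)
Lemma step_function_nnsfun (f : {nnsfun (borel X) >-> R}) (W : set (borel X)) :
  bounded_borel W -> step_function (fun x => f x * \1_W x).
Proof.
move=> [mW [x0 [r Wr]]].
pose s : seq R := finmap.enum_fset (fset_set (range f)).
pose A i := if (i < size s)%N then f @^-1` [set s`_i] `&` W else set0.
(* The absolute value makes the coefficients nonnegative by construction; it
   changes nothing on the level sets that are not empty. *)
exists (size s), A, (fun i => `|s`_i|); split.
- move=> i; rewrite /A; case: ifPn => _; split.
  + exact: measurableI.
  + by exists x0, r => y [_ /Wr].
  + by [].
  + by exists x0, r.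
- move=> i j _ _ [x []]; rewrite /A; case: ifPn => // iN [/= fi _].
  case: ifPn => // jN [/= fj _]; apply/eqP.
  have us : uniq s by exact: finmap.fset_uniq.
  by rewrite -(nth_uniq 0 iN jN us) -fi -fj.
- by [].
- move=> x; rewrite [in LHS]fimfunEord mulr_suml; apply: eq_bigr => i _.
  rewrite /A ltn_ord indicI mulrA; congr (_ * _); rewrite !indicE.
  case: (boolP (x \in _)) => [/set_mem/= fx|_]; last by rewrite !mulr0.
  by rewrite -[in RHS]fx ger0_norm// fx.
Qed.

(** The dyadic approximations of g are cut by larger and larger balls. *)
Lemma step_function_approximation g :
  measurable_fun setT g -> (forall x, 0 <= g x) ->
  exists f : nat -> borel X -> R,
  [/\ forall n, step_function (f n), forall n, measurable_fun setT (f n),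
      forall n x, 0 <= f n x <= g x, forall x, nondecreasing_seq (f ^~ x) &
      forall x, f ^~ x @ \oo --> g x].
Proof.
move=> mg g0; have mEg : measurable_fun setT (EFin \o g).
  exact/measurable_EFinP.
pose f0 := nnsfun_approx measurableT mEg.
have cf0 x : f0 ^~ x @ \oo --> g x.
  have g0' : forall x, setT x -> (0 <= (EFin \o g) x)%E.
    by move=> y _; rewrite lee_fin.
  by have /fine_cvgP[_] := cvg_nnsfun_approx measurableT mEg g0' (I : setT x).
have ndf0 x : nondecreasing_seq (f0 ^~ x).
  by move=> m n mn; exact/lefP/nd_nnsfun_approx.
have f0g n x : f0 n x <= g x.
  rewrite -(cvg_lim (@Rhausdorff R) (cf0 x)).
  apply: nondecreasing_cvgn_le (ndf0 x) _ n.
  by apply/cvg_ex; exists (g x); exact: cf0.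
exists (fun n x => f0 n x * \1_(point_ball n) x); split => [n|n|n x|x m n mn|x].
- exact/step_function_nnsfun/bounded_point_ball.
- apply: measurable_funM => //; apply: measurable_indic.
  by case: (bounded_point_ball n).
- have fnx0 : 0 <= f0 n x by exact: fun_ge0.
  rewrite mulr_ge0//= (le_trans _ (f0g n x))// ler_piMr//.
- by apply: ler_pM => //; [exact: ndf0|exact: indic_point_ball_nondecreasing].
- exact: (cvg_indic_point_ball (f := f0)).
Qed.

End approximation.

Section poisson_laplace.
Local Open Scope ereal_scope.
Context {R : realType} {X : polishMetricType R}.
Variables (kappa : lfMeasure X) (P : probability (pointMeasure X) R).
Hypothesis hP : is_poisson_process kappa P.

Let poisson_laplace_step (g : borel X -> R) : step_function g ->
  \int[P]_mu nexp mu g = nexp kappa (fun x => 1 - expR (- g x))%R.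
Proof.
move=> [n [A [c [bA tA c0 gE]]]].
have mA i : measurable (A i) by case: (bA i).
have kA i : kappa (A i) = (fine (kappa (A i)))%:E.
  by rewrite fineK// ge0_fin_numE// lf_bounded.
pose l i := fine (kappa (A i)).
have l0 i : (0 <= l i)%R by exact: fine_ge0.
transitivity (\int[P]_mu \prod_(i < n) expeR (- ((c i)%:E * mu (A i)))).
  by apply: eq_integral => mu _; rewrite -nexp_step//; congr nexp; apply/funext.
rewrite (@integral_prod_independent_counts _ _ _ P (fun i mu => mu (A i)) n
  (fun i k => l i ^+ k / k`!%:R * expR (- l i))%R _ _ _ _
  (fun i y => expeR (- ((c i)%:E * y))) _ _
  (fun i => expR (- (l i * (1 - expR (- c i))))))//.
- rewrite (_ : (fun x => 1 - expR (- g x))%R =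
    (fun x => \sum_(i < n) (1 - expR (- c i)) * \1_(A i) x)%R); last first.
    apply/funext => x; rewrite gE.
    rewrite (disjoint_step_comp (f := fun y => 1 - expR (- y))%R)//.
    by rewrite oppr0 expR0 subrr.
  rewrite (@nexp_step _ _ kappa n A (fun i => 1 - expR (- c i))%R)//;
    last first.
    by move=> i; rewrite subr_ge0 -expR0 ler_expR oppr_le0.
  rewrite -prodEFin; apply: eq_bigr => i _; rewrite kA -EFinM/= mulrC.
  by rewrite /l.
- by move=> i; exact: measurable_pm_eval.
- by move=> i mu; exact: pm_integer.
- by move=> i k; rewrite mulr_ge0 ?expR_ge0// divr_ge0// exprn_ge0.
- move=> k; transitivity (P [set mu : pointMeasure X |
      forall i : 'I_n, mu (A i) = (k i)%:R%:E]).
    congr (P _); apply/seteqP; split => mu /= h i; first exact: h.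
    by move=> iN; exact: (h (Ordinal iN)).
  rewrite hP; last 2 first.
  - by move=> i; exact: bA.
  - by move=> i j _ _ Aij; apply/val_inj; exact: tA.
  by apply: eq_bigr => i _; rewrite poisson_prob1.
- by move=> i y; exact: expeR_ge0.
- move=> i; apply: (measurableT_comp measurable_expeR).
  apply: measurableT_comp => //; exact: measurable_funeM.
- by move=> i; exact: poisson_generating_function.
Qed.

(** On step functions the integral factorises over the disjoint sets and each
factor is a Poisson generating function; the general case follows by monotone
approximation. *)
Lemma poisson_laplace (g : borel X -> R) :
  measurable_fun setT g -> (forall x, 0 <= g x)%R ->
  \int[P]_mu nexp mu g = nexp kappa (fun x => 1 - expR (- g x))%R.
Proof.
move=> mg g0; have [f [sf mf fg ndf cfg]] := step_function_approximation mg g0.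
have f0 n x : (0 <= f n x)%R by case/andP: (fg n x).
apply: (@cvg_unique _ (@ereal_hausdorff R)
    (\int[P]_mu nexp mu (f n) @[n --> \oo])).
  apply: cvg_integral_le1 => [|n||n mu|mu].
  - exact: le_lt_trans (probability_le1 P measurableT) (ltry _).
  - exact: measurable_nexp_pm.
  - exact: measurable_nexp_pm.
  - by rewrite nexp_ge0 nexp_le1.
  - exact: cvg_nexp_monotone.
rewrite /= (_ : (fun n => \int[P]_mu nexp mu (f n)) =
    (fun n => nexp kappa (fun x => 1 - expR (- f n x))%R)); last first.
  by apply/funext => n; exact: poisson_laplace_step.
apply: cvg_nexp_monotone.
- move=> n; apply: measurable_funB => //; apply: measurableT_comp => //.
  exact: measurableT_comp.
- by move=> n x; rewrite subr_ge0 -expR0 ler_expR oppr_le0.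
- by move=> x m n mn; rewrite lerD2l lerN2 ler_expR lerN2 ndf.
- move=> x; apply: cvgB; first exact: cvg_cst.
  by apply: continuous_cvg; [exact: continuous_expR|exact: cvgN].
Qed.

End poisson_laplace.

(** * Integration against the image of a density *)

(** The map phi makes it possible to change the measurable structure of the
carrier: the measure tau is defined on the real line with its topological Borel
structure, whereas Lebesgue measure lives on the structure generated by
half-open intervals. *)
Section image_of_density.
Local Open Scope ereal_scope.
Context {R : realType} d d' (T : measurableType d) (U : measurableType d').
Variables (mu : {measure set T -> \bar R}) (nu : {measure set U -> \bar R}).
Variables (phi : T -> U) (w : T -> R).
Hypothesis mphi : measurable_fun setT phi.
Hypothesis mw : measurable_fun setT w.
Hypothesis w0 : forall x, (0 <= w x)%R.
Hypothesis nuE : forall A, measurable A ->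
  nu A = \int[mu]_(x in phi @^-1` A) (w x)%:E.

Import HBNNSimple.

Let integral_image_density_nnsfun (f : {nnsfun U >-> R}) :
  \int[nu]_y (f y)%:E = \int[mu]_x (f (phi x) * w x)%:E.
Proof.
rewrite integralT_nnsfun sintegralE.
transitivity (\sum_(r \in range f)
    \int[mu]_x (r * (\1_(f @^-1` [set r]) (phi x) * w x))%:E).
  apply: eq_fsbigr => r /set_mem[t _ <-{r}].
  have mf : measurable (f @^-1` [set f t]) by [].
  have mpf : measurable (phi @^-1` (f @^-1` [set f t])).
    by rewrite -[X in measurable X]setTI; exact: mphi.
  rewrite nuE// integral_mkcond -ge0_integralZl//; last 3 first.
  - by apply/measurable_restrict => //; apply/measurable_funTS/measurable_EFinP.
  - by move=> x _; rewrite patchE; case: ifPn; rewrite // lee_fin.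
  - by rewrite lee_fin.
  apply: eq_integral => x _; rewrite patchE indicE.
  have -> : (x \in phi @^-1` (f @^-1` [set f t])) =
      (phi x \in f @^-1` [set f t]).
    by apply/idP/idP => /set_mem ?; apply/mem_set.
  by case: ifPn => _; rewrite ?mul1r// mul0r mulr0 mule0.
rewrite -ge0_integral_fsum//; last 2 first.
- move=> r; apply/measurable_EFinP; apply: measurable_funM => //.
  apply: measurable_funM => //.
  have mr : measurable_fun setT (\1_(f @^-1` [set r]) : U -> R).
    exact: measurable_indic.
  exact: (measurableT_comp mr mphi).
- move=> r x _; rewrite lee_fin indicE; case: (boolP (_ \in _)).
    by move=> /set_mem/= <-; rewrite mulr_ge0// mul1r.
  by rewrite mul0r mulr0.
apply: eq_integral => x _; rewrite fsbig_finite//= sumEFin.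
congr EFin; rewrite [in RHS]fimfunE fsbig_finite//= mulr_suml.
by apply: eq_bigr => i _; rewrite mulrA.
Qed.

Lemma integral_image_density (f : U -> R) : measurable_fun setT f ->
  (forall y, 0 <= f y)%R ->
  \int[nu]_y (f y)%:E = \int[mu]_x (f (phi x) * w x)%:E.
Proof.
move=> mf f0; have mEf : measurable_fun setT (EFin \o f).
  exact/measurable_EFinP.
have Ef0 x : setT x -> (0 <= (EFin \o f) x) by rewrite lee_fin.
pose g := nnsfun_approx measurableT mEf.
have ndg x : nondecreasing_seq (g ^~ x).
  by move=> m n mn; exact/lefP/nd_nnsfun_approx.
have cg x : (g n x)%:E @[n --> \oo] --> (f x)%:E.
  exact: cvg_nnsfun_approx.
transitivity (limn (fun n => \int[nu]_x (g n x)%:E)).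
  rewrite -monotone_convergence//.
  - by apply: eq_integral => x _; apply/esym/cvg_lim.
  - by move=> n; exact/measurable_EFinP.
  - by move=> n x _; rewrite lee_fin.
  - by move=> x _ m n mn; rewrite lee_fin ndg.
rewrite (_ : (fun n => \int[nu]_x (g n x)%:E) =
    (fun n => \int[mu]_x (g n (phi x) * w x)%:E)); last first.
  by apply/funext => n; exact: integral_image_density_nnsfun.
rewrite -monotone_convergence//.
- apply: eq_integral => x _; apply/cvg_lim => //.
  under eq_fun do rewrite EFinM.
  rewrite EFinM; apply: cvgeM; [by []|exact: cg|exact: cvg_cst].
- move=> n; apply/measurable_EFinP; apply: measurable_funM => //.
  exact: measurableT_comp.
- by move=> n x _; rewrite lee_fin mulr_ge0.
- by move=> x _ m n mn; rewrite lee_fin ler_wpM2r// ndg.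
Qed.

End image_of_density.

(** * The exponent of the Poisson-Gamma law *)

Section frullani.
Local Open Scope ereal_scope.
Context {R : realType}.
Implicit Types a c r s z : R.
Notation mu := (@lebesgue_measure R).

Let integral_inv_shift c a : (0 < c)%R -> (0 < a)%R ->
  \int[mu]_(s in `[0%R, a]) ((c + s)^-1)%:E = (ln (1 + a / c))%:E.
Proof.
move=> c0 a0.
have cs0 s : s \in `]0%R, a[ -> (0 < c + s)%R.
  by rewrite in_itv/= => /andP[s0 _]; rewrite addr_gt0.
have ccs s : (0 <= s)%R -> {for s, continuous (fun s => ln (c + s))}.
  move=> s0; apply: continuous_comp.
    by apply: cvgD; [exact: cvg_cst|exact: cvg_id].
  by apply: continuous_ln; rewrite ltr_wpDr.
rewrite (@continuous_FTC2 _ _ (fun s => ln (c + s))%R)//.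
- rewrite addr0 -EFinB -ln_div ?posrE//; last by rewrite addr_gt0.
  by congr (ln _)%:E; rewrite mulrDl divff// gt_eqF.
- apply: continuous_in_subspaceT => s /set_mem/=.
  rewrite in_itv/= => /andP[s0 _].
  apply: cvgV; first by rewrite gt_eqF// ltr_wpDr.
  by apply: cvgD; [exact: cvg_cst|exact: cvg_id].
- split.
  + move=> s sa; apply: ex_derive; apply: is_derive1_comp.
    by apply: is_derive1_ln; exact: cs0.
  + by apply/cvg_at_right_filter; exact: ccs.
  + by apply/cvg_at_left_filter; apply: ccs; exact: ltW.
- move=> s sa; rewrite derive1E.
  have dln := @is_derive1_ln R (c + s)%R (cs0 _ sa).
  have dc : is_derive s 1%R (fun s : R => c + s)%R (0 + 1)%R.
    by apply: is_deriveD.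
  have := is_derive1_comp dln dc.
  rewrite add0r mulr1 => dlc; exact: (@derive_val _ _ _ _ _ _ _ dlc).
Qed.

Let integral_expR_itv r a : (0 < r)%R -> (0 < a)%R ->
  \int[mu]_(s in `[0%R, a]) (expR (- (s * r)))%:E =
  (r^-1 * (1 - expR (- (r * a))))%:E.
Proof.
move=> r0 a0; rewrite EFinM EFinB -mulNr -exponential_prob_itv0c//.
rewrite /exponential_prob -ge0_integralZl//; last 3 first.
- by apply/measurable_funTS/measurable_EFinP; exact: measurable_exponential_pdf.
- by move=> s _; rewrite lee_fin exponential_pdf_ge0// ltW.
- by rewrite lee_fin invr_ge0 ltW.
apply: eq_integral => s; rewrite inE/= in_itv/= => /andP[s0 _].
by rewrite exponential_pdfE// -EFinM mulKf ?gt_eqF// mulNr mulrC.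
Qed.

Let integral_expR_itvy c : (0 < c)%R ->
  \int[mu]_(r in `]0%R, +oo[) (expR (- (c * r)))%:E = (c^-1)%:E.
Proof.
move=> c0; rewrite integral_itv_obnd_cbnd//; last first.
  apply/measurable_funTS/measurable_EFinP; apply: measurableT_comp => //.
  by apply: measurableT_comp => //; exact: measurable_funM.
transitivity (\int[mu]_(r in `[0%R, +oo[)
    ((c^-1)%:E * (exponential_pdf c r)%:E)).
  apply: eq_integral => r; rewrite inE/= in_itv/= andbT => r0.
  by rewrite exponential_pdfE// -EFinM mulKf ?gt_eqF// mulNr.
rewrite ge0_integralZl//; last 3 first.
- by apply/measurable_funTS/measurable_EFinP; exact: measurable_exponential_pdf.
- by move=> s _; rewrite lee_fin exponential_pdf_ge0// ltW.
- by rewrite lee_fin invr_ge0 ltW.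
rewrite -[RHS]mule1; congr (_ * _); rewrite -(integral_exponential_pdf c0).
rewrite [LHS]integral_mkcond; apply: eq_integral => r _.
rewrite patchE; case: ifPn => // r0; rewrite /exponential_pdf patchE.
by rewrite (negbTE r0).
Qed.

(** Frullani: (1 - e^{-ra}) / r is the integral of e^{-rs} over s in [0, a].
Exchanging the integrals leaves the integral of 1 / (c + s) over [0, a]. *)
Lemma integral_gamma_levy_density c a : (0 < c)%R -> (0 <= a)%R ->
  \int[mu]_(r in `]0%R, +oo[)
    ((1 - expR (- (r * a))) * (r^-1 * expR (- c * r)))%:E =
  (ln (1 + a / c))%:E.
Proof.
move=> c0; rewrite le_eqVlt => /predU1P[<-|a0].
  rewrite mul0r addr0 ln1; apply: integral0_eq => r _.
  by rewrite mulr0 oppr0 expR0 subrr mul0r.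
pose k (rs : R * R) : \bar R :=
  (\1_(`]0%R, +oo[%classic) rs.1 * \1_(`[0%R, a]%classic) rs.2 *
   expR (- ((c + rs.2) * rs.1)))%:E.
have k0 rs : 0 <= k rs by rewrite lee_fin !mulr_ge0 ?expR_ge0.
have mk : measurable_fun setT k.
  apply/measurable_EFinP; apply: measurable_funM.
    by apply: measurable_funM; apply: measurableT_comp => //;
      exact: measurable_indic.
  apply: measurableT_comp => //; apply: measurableT_comp => //.
  by apply: measurable_funM => //; exact: measurable_funD.
transitivity (\int[mu]_r \int[mu]_s k (r, s)).
  rewrite integral_mkcond; apply: eq_integral => r _; rewrite patchE /k/=.
  rewrite indicE; case: ifPn => [|_]; last first.
    by under eq_integral do rewrite !mul0r; rewrite integral0.
  rewrite inE/= in_itv/= andbT => r0.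
  transitivity (\int[mu]_(s in `[0%R, a])
     ((expR (- (c * r)))%:E * (expR (- (s * r)))%:E)).
    rewrite ge0_integralZl//; last first.
      apply/measurable_funTS/measurable_EFinP; apply: measurableT_comp => //.
      by apply: measurableT_comp => //; exact: measurable_funM.
    by rewrite integral_expR_itv// -EFinM mulNr mulrCA mulrA mulrC mulrA.
  rewrite integral_mkcond; apply: eq_integral => s _.
  rewrite mul1r indicE patchE; case: ifPn => _; last by rewrite mul0r.
  by rewrite mul1r -EFinM -expRD mulrDl opprD.
rewrite (@fubini_tonelli _ _ _ _ _ mu mu k mk k0)/=.
rewrite -(integral_inv_shift c0 a0) [RHS]integral_mkcond.
apply: eq_integral => s _; rewrite /k/= patchE.
case: ifPn => sa; last first.
  apply: integral0_eq => r _.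
  by rewrite [X in (_ * X * _)%R]indicE (negbTE sa) mulr0 mul0r.
have cs0 : (0 < c + s)%R.
  by move: sa; rewrite inE/= in_itv/= => /andP[s0 _]; rewrite ltr_wpDr.
rewrite -(integral_expR_itvy cs0) [RHS]integral_mkcond.
apply: eq_integral => r _; rewrite [X in (_ * X * _)%R]indicE sa mulr1.
by rewrite patchE indicE; case: ifPn => _; rewrite ?mul1r ?mul0r.
Qed.

Lemma gamma_exponent z a : (0 < z < 1)%R -> (0 <= a)%R ->
  \int[tau z]_(r in `]0%R, +oo[) (1 - expR (- (r * a)))%:E =
  (ln (1 + a * (z / (1 - z))))%:E.
Proof.
move=> /andP[z0 z1] a0; pose c := ((1 - z) / z)%R.
have c0 : (0 < c)%R by rewrite divr_gt0// subr_gt0.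
rewrite (_ : z / (1 - z) = c^-1)%R; last by rewrite invf_div.
rewrite -(integral_gamma_levy_density c0 a0) integral_mkcond.
pose f := (fun r => 1 - expR (- (r * a)))%R \_ `]0%R, +oo[.
have mf : measurable_fun setT f.
  apply/measurable_restrict => //; apply: measurable_funTS.
  apply: measurable_funB => //; apply: measurableT_comp => //.
  by apply: measurableT_comp => //; exact: measurable_funM.
have f0 r : (0 <= f r)%R.
  apply: restrict_ge0 => {}r /=; rewrite in_itv/= andbT => r0.
  by rewrite subr_ge0 -expR0 ler_expR oppr_le0 mulr_ge0// ltW.
transitivity (\int[tau z]_r (f r)%:E).
  by apply: eq_integral => r _; rewrite /f !patchE; case: ifPn.
have -> : \int[tau z]_r (f r)%:E = \int[mu]_r (f r * tau_density z r)%:E.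
  have mid : measurable_fun setT (id : measurableTypeR R -> R).
    by move=> _ A mA; rewrite setTI.
  exact: (integral_image_density mid (measurable_tau_density z)
    (tau_density_ge0 z)).
rewrite [RHS]integral_mkcond; apply: eq_integral => r _.
by rewrite /f /tau_density !patchE; case: ifPn => // _; rewrite mul0r.
Qed.

End frullani.

(** * The joint Laplace transform of a configuration and its intensity *)

Section poisson_gamma_laplace.
Local Open Scope ereal_scope.
Context {R : realType} {X : polishMetricType R}.
Implicit Types (g h : borel X -> R).

Lemma measurable_ln1D (c : R) d (T : measurableType d) (h : T -> R) :
  measurable_fun setT h -> measurable_fun setT (fun x => ln (1 + c * h x)).
Proof.
move=> mh; apply: measurableT_comp => //; apply: measurable_funD => //.
exact: measurable_funM.
Qed.

Lemma ln1D_ge0 (c y : R) : (0 <= c -> 0 <= y -> 0 <= ln (1 + c * y))%R.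
Proof. by move=> c0 y0; rewrite ln_ge0// lerDl mulr_ge0. Qed.

(** The form of the Laplace transform in which conjugacy becomes an identity
between rational functions. *)
Lemma is_poisson_gamma_nexp (z : R) (rho : lfMeasure X)
    (D : {measure set (lfMeasure X) -> \bar R}) : (0 < z < 1)%R ->
  is_poisson_gamma z rho D <->
  forall h, bounded_nonneg_measurable h ->
    laplace D h = nexp rho (fun x => ln (1 + z / (1 - z) * h x)).
Proof.
move=> z01; apply: (iff_trans (is_poisson_gammaE z rho D)).
split=> H h bh; rewrite H//; case: (bh) => mh h0 _; rewrite /nexp;
  congr (expeR (- _)); apply: eq_integral => x _;
  by rewrite gamma_exponent// mulrC.
Qed.

Lemma bounded_nonneg_measurable_1expR g :
  measurable_fun setT g -> (forall x, 0 <= g x)%R ->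
  bounded_nonneg_measurable (fun x => 1 - expR (- g x))%R.
Proof.
move=> mg g0; split.
- apply: measurable_funB => //; apply: measurableT_comp => //.
  exact: measurableT_comp.
- by move=> x; rewrite subr_ge0 -expR0 ler_expR oppr_le0.
- by exists 1%R => x; rewrite lerBlDr lerDl expR_ge0.
Qed.

Lemma bounded_nonneg_measurableD g h :
  bounded_nonneg_measurable g -> bounded_nonneg_measurable h ->
  bounded_nonneg_measurable (fun x => g x + h x)%R.
Proof.
move=> [mg g0 [M gM]] [mh h0 [N hN]]; split.
- exact: measurable_funD.
- by move=> x; rewrite addr_ge0.
- by exists (M + N)%R => x; rewrite lerD.
Qed.

End poisson_gamma_laplace.

Section bayes_laplace.
Local Open Scope ereal_scope.
Context {R : realType} {X : polishMetricType R}.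
Variables (z : R) (rho : lfMeasure X).
Hypothesis hz : (0 < z < 1)%R.
Variables (P : lfMeasure X -> probability (pointMeasure X) R).
Hypothesis hP : forall kappa, is_poisson_process kappa (P kappa).
Variable D : probability (lfMeasure X) R.
Hypothesis hD : is_poisson_gamma z rho D.
Variables (S : probability (pointMeasure X) R)
  (B : R.-pker (pointMeasure X) ~> (lfMeasure X)).
Hypothesis hB : is_bayes_kernel P D S B.
Implicit Types (g h : borel X -> R) (mu : pointMeasure X) (kappa : lfMeasure X).

Let w := (z / (1 - z))%R.

Let z0 : (0 < z)%R. Proof. by case/andP: hz. Qed.

Let z1 : (0 < 1 - z)%R. Proof. by case/andP: hz; rewrite subr_gt0. Qed.

Let w0 : (0 <= w)%R. Proof. by rewrite divr_ge0 ?ltW. Qed.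

(** Disintegration with respect to the intensity: the inner integral over the
configuration is a Poisson Laplace transform, and the outer one is the Laplace
transform of the prior at h + 1 - e^{-g}. *)
Let integral_joint_laplace g h :
  bounded_nonneg_measurable g -> bounded_nonneg_measurable h ->
  \int[S]_mu (laplace (B mu) h * nexp mu g) =
  nexp rho (fun x => ln (1 + w * (h x + (1 - expR (- g x)))))%R.
Proof.
move=> bg bh; have [mg g0 _] := bg; have [mh h0 _] := bh.
pose f (p : pointMeasure X * lfMeasure X) := nexp p.2 h * nexp p.1 g.
have mf : measurable_fun setT f.
  apply: emeasurable_funM.
    by apply: (measurableT_comp (measurable_nexp_lf mh h0)).
  by apply: (measurableT_comp (measurable_nexp_pm mg g0)).
transitivity (\int[S]_mu \int[B mu]_kappa f (mu, kappa)).
  apply: eq_integral => mu _; rewrite /f/= ge0_integralZr ?nexp_ge0//.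
  - exact: measurable_nexp_lf.
  - by move=> kappa _; exact: nexp_ge0.
rewrite -hB//; last by move=> p; rewrite mule_ge0 ?nexp_ge0.
transitivity (laplace D (fun x => h x + (1 - expR (- g x))))%R.
  apply: eq_integral => kappa _; rewrite /f/= ge0_integralZl ?nexp_ge0//.
  - have [m1 p1 _] := bounded_nonneg_measurable_1expR mg g0.
    by rewrite (poisson_laplace (hP kappa))// -nexpD.
  - exact: measurable_nexp_pm.
  - by move=> mu _; exact: nexp_ge0.
have := (is_poisson_gamma_nexp rho D hz).1 hD; apply.
apply: bounded_nonneg_measurableD => //.
exact: bounded_nonneg_measurable_1expR.
Qed.

(** The Bayes identity for functions of mu alone identifies S as the mixture of
the Poisson laws under the prior. *)
Let laplace_marginal g : measurable_fun setT g -> (forall x, 0 <= g x)%R ->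
  \int[S]_mu nexp mu g =
  nexp rho (fun x => ln (1 + w * (1 - expR (- g x))))%R.
Proof.
move=> mg g0.
transitivity (\int[S]_mu \int[B mu]_kappa nexp mu g).
  apply: eq_integral => mu _; rewrite integral_cst//.
  by rewrite prob_kernel mule1.
rewrite -(hB (f := fun p => nexp p.1 g)); last 2 first.
- by apply: (measurableT_comp (measurable_nexp_pm mg g0)).
- by move=> p; exact: nexp_ge0.
have bg := bounded_nonneg_measurable_1expR mg g0.
transitivity (laplace D (fun x => 1 - expR (- g x)))%R.
  by apply: eq_integral => kappa _; rewrite (poisson_laplace (hP kappa)).
exact: ((is_poisson_gamma_nexp rho D hz).1 hD).
Qed.

(** The conjugacy identity: the logarithms of the two factors of
1 + w (h + 1 - e^{-g}) are integrated separately against rho. *)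
Lemma bayes_laplace g h :
  bounded_nonneg_measurable g -> bounded_nonneg_measurable h ->
  \int[S]_mu (laplace (B mu) h * nexp mu g) =
  \int[S]_mu (nexp (lf_add rho mu) (fun x => ln (1 + z * h x))%R * nexp mu g).
Proof.
move=> bg bh; have [mg g0 _] := bg; have [mh h0 _] := bh.
pose l x := ln (1 + z * h x).
have ml : measurable_fun setT l by exact: measurable_ln1D.
have l0 x : (0 <= l x)%R by rewrite ln1D_ge0// ltW.
have mgl : measurable_fun setT (fun x => l x + g x)%R.
  exact: measurable_funD.
have gl0 x : (0 <= l x + g x)%R by rewrite addr_ge0.
have [mv v0 _] := bounded_nonneg_measurable_1expR mgl gl0.
rewrite integral_joint_laplace//.
transitivity (\int[S]_mu (nexp rho l * nexp mu (fun x => l x + g x)%R)).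
  rewrite ge0_integralZl ?nexp_ge0//; last 2 first.
  - exact: measurable_nexp_pm.
  - by move=> mu _; exact: nexp_ge0.
  rewrite laplace_marginal// -nexpD//; last 2 first.
  - exact: measurable_ln1D.
  - by move=> x; rewrite ln1D_ge0.
  congr (nexp rho _); apply/funext => x; rewrite /l.
  have zh0 : (0 < 1 + z * h x)%R by rewrite ltr_wpDr// mulr_ge0// ltW.
  rewrite -lnM ?posrE//; last first.
    by rewrite ltr_wpDr// mulr_ge0//; exact: v0.
  congr ln; rewrite opprD expRD (expRN (ln _)) lnK ?posrE// /w.
  by field; rewrite !gt_eqF.
apply: eq_integral => mu _.
by rewrite nexp_lf_add// nexpD// muleA.
Qed.

Lemma measurable_laplace_kernel h : bounded_nonneg_measurable h ->
  measurable_fun setT (fun mu => laplace (B mu) h).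
Proof.
move=> [mh h0 _]; apply: measurable_fun_integral_kernel.
- by move=> U mU; exact: measurable_kernel.
- by move=> kappa; exact: nexp_ge0.
- exact: measurable_nexp_lf.
Qed.

End bayes_laplace.

(** * Dirichlet series and pi-systems *)

Section dirichlet_series.
Local Open Scope ereal_scope.
Context {R : realType}.

Lemma fin_num_addeI (x y y' : \bar R) :
  x \is a fin_num -> x + y = x + y' -> y = y'.
Proof.
by move=> xfin /(congr1 (fun u => u - x)); rewrite !(addeC x) !addeK.
Qed.

Let dirichlet a (t : nat) : \bar R :=
  \sum_(j <oo) (expR (- (t%:R * j%:R)))%:E * a j.

(** If the coefficients agree below k, the series agree after removal of these
terms; multiplying by e^{tk} gives a k <= b k + e^{-t} C, where C is the sum of
b, and t goes to infinity. *)
Let dirichlet_le (a b : nat -> \bar R) k :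
  (forall j, 0 <= a j) -> (forall j, 0 <= b j) ->
  \sum_(j <oo) b j < +oo -> (forall t, dirichlet a t = dirichlet b t) ->
  (forall j, (j < k)%N -> a j = b j) -> a k <= b k.
Proof.
move=> a0 b0 bfin ab abk.
pose e (t j : nat) : R := expR (- (t%:R * j%:R)).
have e0 t j : 0 <= (e t j)%:E by rewrite lee_fin expR_ge0.
have bj j : b j \is a fin_num.
  rewrite ge0_fin_numE//; apply: le_lt_trans bfin.
  apply: le_trans (nneseries_lim_ge j.+1 _) => [|//].
  by rewrite big_nat_recr//= leeDr// sume_ge0.
have [C Cb] : exists C : R, \sum_(j <oo) b j = C%:E.
  exists (fine (\sum_(j <oo) b j)); rewrite fineK// ge0_fin_numE//.
  exact: nneseries_ge0.
have C0 : (0 <= C)%R by rewrite -lee_fin -Cb nneseries_ge0.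
have tail t : \sum_(k <= j <oo) (e t j)%:E * a j =
    \sum_(k <= j <oo) (e t j)%:E * b j.
  have := ab t; rewrite /dirichlet (@nneseries_split _ _ 0 k); last first.
    by move=> j _; rewrite mule_ge0// e0.
  rewrite (@nneseries_split _ (fun j => _ * b j) 0 k); last first.
    by move=> j _; rewrite mule_ge0// e0.
  rewrite add0n (_ : (\sum_(0 <= j < k) _ * a j =
      \sum_(0 <= j < k) (e t j)%:E * b j)); last first.
    by apply: eq_big_nat => j /andP[_ jk]; rewrite abk.
  apply: fin_num_addeI; apply/sum_fin_numP => j _ _.
  by rewrite fin_numM.
have key t : a k <= b k + (expR (- t%:R) * C)%:E.
  have ek0 : (0 < e t k)%R by exact: expR_gt0.
  rewrite -(@lee_pmul2l _ (e t k)%:E)//.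
  rewrite ge0_muleDr//; last by rewrite lee_fin mulr_ge0 ?expR_ge0.
  apply: (@le_trans _ _ (\sum_(k <= j <oo) (e t j)%:E * a j)).
    rewrite (@nneseries_split _ _ k 1); last first.
      by move=> j _; rewrite mule_ge0// e0.
    rewrite addn1 big_nat1 leeDl// nneseries_ge0// => j _ _.
    by rewrite mule_ge0// e0.
  rewrite tail (@nneseries_split _ _ k 1); last first.
    by move=> j _; rewrite mule_ge0// e0.
  rewrite addn1 big_nat1 leeD2l//.
  apply: (@le_trans _ _ (\sum_(k.+1 <= j <oo) (e t k.+1)%:E * b j)).
    rewrite ereal_series_cond [leRHS]ereal_series_cond.
    apply: lee_nneseries => [j _ _|j]; first by rewrite mule_ge0// e0.
    rewrite andbT => kj; rewrite lee_wpmul2r// lee_fin ler_expR lerN2.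
    by rewrite ler_wpM2l// ler_nat.
  rewrite nneseriesZl// -EFinM mulrA.
  have -> : (e t k * expR (- t%:R) = e t k.+1)%R.
    by rewrite /e -expRD -[k.+1]addn1 natrD; congr expR; ring.
  rewrite EFinM lee_wpmul2l//.
  rewrite -Cb (@nneseries_split _ _ 0 k.+1)// add0n leeDr//.
  by apply: sume_ge0.
(* Since e^t >= t, any t >= C / d makes e^{-t} C at most d. *)
apply/lee_addgt0Pr => d d0; apply: (le_trans (key (Num.truncn (C / d)).+1)).
rewrite leeD2l// lee_fin expRN.
rewrite ler_pdivrMl ?expR_gt0//.
have Cd : (C / d <= (Num.truncn (C / d)).+1%:R)%R by exact/ltW/truncnS_gt.
rewrite -ler_pdivrMr//; apply: (le_trans Cd).
by rewrite (le_trans _ (expR_ge1Dx _))// lerDr.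
Qed.

Lemma dirichlet_series_inj (a b : nat -> \bar R) :
  (forall j, 0 <= a j) -> (forall j, 0 <= b j) ->
  \sum_(j <oo) a j < +oo -> \sum_(j <oo) b j < +oo ->
  (forall t : nat, \sum_(j <oo) (expR (- (t%:R * j%:R)))%:E * a j =
    \sum_(j <oo) (expR (- (t%:R * j%:R)))%:E * b j) -> a =1 b.
Proof.
move=> a0 b0 afin bfin ab k; elim/ltn_ind: k => k IH.
apply/eqP; rewrite eq_le dirichlet_le//= dirichlet_le// => [t|j jk].
  by rewrite /dirichlet ab.
by rewrite IH.
Qed.

End dirichlet_series.

Section pi_system.
Local Open Scope ereal_scope.
Context {R : realType} d (T : measurableType d).
Variable mu : {finite_measure set T -> \bar R}.

(** The sets on which f and g have the same integral form a Dynkin system. *)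
Lemma ae_eq_pi_system (H : set (set T)) (f g : T -> \bar R) :
  measurable = <<s H >> -> setI_closed H -> H setT ->
  measurable_fun setT f -> measurable_fun setT g ->
  (forall x, 0 <= f x <= 1) -> (forall x, 0 <= g x <= 1) ->
  (forall E, H E -> \int[mu]_(x in E) f x = \int[mu]_(x in E) g x) ->
  ae_eq mu setT f g.
Proof.
move=> sH HI HT mf mg f01 g01 Hfg.
have f0 x : 0 <= f x by case/andP: (f01 x).
have g0 x : 0 <= g x by case/andP: (g01 x).
have intT (h : T -> \bar R) : measurable_fun setT h ->
    (forall x, 0 <= h x <= 1) -> mu.-integrable setT h.
  move=> mh h01; apply: (le_integrable measurableT mh (g := cst 1)).
    by move=> x _; case/andP: (h01 x) => h0 h1; rewrite gee0_abs//= normr1.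
  exact: finite_measure_integrable_cst.
have finE (h : T -> \bar R) E : measurable_fun setT h ->
    (forall x, 0 <= h x <= 1) -> measurable E ->
    \int[mu]_(x in E) h x \is a fin_num.
  move=> mh h01 mE; apply: integrable_fin_num => //.
  by apply: integrableS (intT h mh h01).
apply: integral_ae_eq => //; first exact: intT.
move=> E _; rewrite sH => HE; move: E HE.
apply: (dynkin_induction sH HI).
- exact: Hfg.
- exact: Hfg.
- move=> E mE fgE; have := Hfg _ HT.
  have split h : measurable_fun setT h -> (forall x, 0 <= h x) ->
      \int[mu]_x h x = \int[mu]_(x in E) h x + \int[mu]_(x in ~` E) h x.
    move=> mh h0; rewrite -{1}(setUv E) ge0_integral_setU ?setUv//.
      exact: measurableC.
    exact/disj_setPCl.
  by rewrite !split// fgE; apply: fin_num_addeI; exact: finE.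
- move=> F mF tF fgF.
  rewrite !ge0_integral_bigcup//; [|exact: measurable_funTS..].
  by apply: eq_eseriesr => n _.
Qed.

End pi_system.

(** * Laplace transforms separate measures on point measures *)

Section point_measure_uniqueness.
Local Open Scope ereal_scope.
Context {R : realType} {X : polishMetricType R}.
Implicit Types (mu : pointMeasure X) (A : nat -> set (borel X)).

Definition counts n A (k : nat -> nat) : set (pointMeasure X) :=
  [set mu | forall i, (i < n)%N -> mu (A i) = (k i)%:R%:E].

Definition count_events : set (set (pointMeasure X)) :=
  [set E | exists n A k, (forall i, bounded_borel (A i)) /\ E = counts n A k].

Lemma measurable_counts n A k : (forall i, bounded_borel (A i)) ->
  measurable (counts n A k).
Proof.
move=> bA; rewrite (_ : counts n A k = \bigcap_(i in [set i | (i < n)%N])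
  ((fun mu : pointMeasure X => mu (A i)) @^-1` [set (k i)%:R%:E]))//.
apply: bigcap_measurableType => i _; rewrite -[X in measurable X]setTI.
by apply: measurable_pm_eval => //; case: (bA i).
Qed.

Lemma bounded_borel0 : bounded_borel (set0 : set (borel X)).
Proof. by split=> //; exists point, 0%R. Qed.

Lemma setI_closed_count_events : setI_closed count_events.
Proof.
move=> _ _ [n1 [A1 [k1 [b1 ->]]]] [n2 [A2 [k2 [b2 ->]]]].
(* The second event is shifted behind the first one. *)
pose glue T (u v : nat -> T) i := if (i < n1)%N then u i else v (i - n1)%N.
exists (n1 + n2)%N, (glue _ A1 A2), (glue _ k1 k2); split.
  by move=> i; rewrite /glue; case: ifP.
apply/seteqP; split => mu.
  move=> [h1 h2] i iN; rewrite /glue; case: ifPn => [/h1//|].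
  by rewrite -leqNgt => n1i; apply: h2; rewrite ltn_subLR.
move=> h; split => i iN.
  by have := h i; rewrite /glue iN; apply; rewrite ltn_addr.
have := h (n1 + i)%N; rewrite ltn_add2l /glue (ltnNge _ n1) leq_addr/= addKn.
exact.
Qed.

(** Counts are integers, so the event that mu(A) lies in Y is a countable union
of events fixing mu(A). *)
Lemma measurable_count_events :
  (@measurable _ (pointMeasure X)) = <<s count_events >>.
Proof.
apply/seteqP; split; last first.
  apply: smallest_sub; first exact: sigma_algebra_measurable.
  by move=> _ [n [A [k [bA ->]]]]; exact: measurable_counts.
apply: smallest_sub; first exact: smallest_sigma_algebra.
move=> _ [A bA [Y mY <-]]; rewrite setTI.
pose C j := counts 1 (fun=> A) (fun=> j).
rewrite (_ : _ @^-1` Y = \bigcup_j (C j `&` [set _ | Y j%:R%:E])); last first.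
  apply/seteqP; split => mu /=.
    have [j muA] := pm_integer mu bA; rewrite /= muA => Yj.
    by exists j => //; split => // i _.
  by move=> [j _ [Cj Yj]]; rewrite /= (Cj 0%N).
apply: sigma_algebra_bigcup => j; have [Yj|Yj] := pselect (Y j%:R%:E).
  rewrite (_ : [set _ | _] = setT) ?setIT; last by apply/seteqP; split.
  by apply: sub_sigma_algebra; exists 1%N, (fun=> A), (fun=> j).
rewrite (_ : [set _ | _] = set0) ?setI0; last by apply/seteqP; split.
exact: sigma_algebra0.
Qed.

Variables (S : probability (pointMeasure X) R).
Variables F G : pointMeasure X -> \bar R.
Hypotheses (mF : measurable_fun setT F) (mG : measurable_fun setT G).
Hypothesis F01 : forall mu, 0 <= F mu <= 1.
Hypothesis G01 : forall mu, 0 <= G mu <= 1.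
Hypothesis FG : forall g : borel X -> R, bounded_nonneg_measurable g ->
  \int[S]_mu (F mu * nexp mu g) = \int[S]_mu (G mu * nexp mu g).

(** Testing with g + t 1_{A n} weights the event on which the count of A n is j
by e^{-tj}, whence a Dirichlet series in t. *)
Let split_counts (H : pointMeasure X -> \bar R) n A k g (t : nat) :
  measurable_fun setT H -> (forall mu, 0 <= H mu <= 1) ->
  (forall i, bounded_borel (A i)) -> bounded_nonneg_measurable g ->
  \int[S]_(mu in counts n A k)
    (H mu * nexp mu (fun x => g x + t%:R * \1_(A n) x)%R) =
  \sum_(j <oo) (expR (- (t%:R * j%:R)))%:E *
    \int[S]_(mu in counts n.+1 A (fun i => if i == n then j else k i))
      (H mu * nexp mu g).
Proof.
move=> mH H01 bA [mg g0 _]; have mA : measurable (A n) by case: (bA n).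
have H0 mu : 0 <= H mu by case/andP: (H01 mu).
pose kj j i := if i == n then j else k i.
have -> : counts n A k = \bigcup_j counts n.+1 A (kj j).
  apply/seteqP; split => mu.
    move=> muk; have [j muj] := pm_integer mu (bA n); exists j => // i.
    rewrite ltnS leq_eqVlt /kj; case: eqVneq => [->//|_ /= iN]; exact: muk.
  move=> [j _ muj] i iN; rewrite muj ?(ltnW iN)//; last exact: ltnW.
  by rewrite /kj ltn_eqF.
have mt : measurable_fun setT (fun x => t%:R * \1_(A n) x : R)%R.
  by apply: measurable_funM => //; exact: measurable_indic.
have mgt : measurable_fun setT (fun x => g x + t%:R * \1_(A n) x)%R.
  exact: measurable_funD.
have t0 x : (0 <= t%:R * \1_(A n) x :> R)%R by rewrite mulr_ge0.
have gt0 x : (0 <= g x + t%:R * \1_(A n) x)%R by rewrite addr_ge0.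
rewrite ge0_integral_bigcup//; last 4 first.
- by move=> j; exact: measurable_counts.
- apply: measurable_funTS; apply: emeasurable_funM => //.
  exact: measurable_nexp_pm.
- by move=> mu _; rewrite mule_ge0// nexp_ge0.
- apply/trivIsetP => i j _ _ ij; apply/seteqP; split => // mu [mui muj].
  move/eqP: ij; apply; have := mui n; have := muj n.
  rewrite ltnSn /kj eqxx => -> // /(_ isT)[] /eqP.
  by rewrite eqr_nat => /eqP.
apply: eq_eseriesr => j _.
rewrite -ge0_integralZl//; last 3 first.
- exact: measurable_counts.
- apply: measurable_funTS; apply: emeasurable_funM => //.
  exact: measurable_nexp_pm.
- by move=> mu _; rewrite mule_ge0// nexp_ge0.
apply: eq_integral => mu; rewrite inE => muj.
rewrite nexpD// muleA muleC; congr (_ * _).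
rewrite /nexp (_ : \int[mu]_x _ = (t%:R * j%:R)%:E)//.
under eq_integral do rewrite EFinM.
rewrite ge0_integralZl//; last first.
  by apply/measurable_EFinP; exact: measurable_indic.
by rewrite integral_indic// setIT muj// /kj eqxx EFinM.
Qed.

(** Induction on n.  The values for all t of the Dirichlet series of
[split_counts] are integrals over an event on n counts, which agree by
induction, and a Dirichlet series determines its coefficients. *)
Let integral_counts n A k g :
  (forall i, bounded_borel (A i)) -> bounded_nonneg_measurable g ->
  \int[S]_(mu in counts n A k) (F mu * nexp mu g) =
  \int[S]_(mu in counts n A k) (G mu * nexp mu g).
Proof.
elim: n k g => [|n IH] k g bA bg.
  rewrite (_ : counts 0 A k = setT); first exact: FG.
  by apply/seteqP; split.
have [mg g0 _] := bg.
pose a (H : pointMeasure X -> \bar R) j := \int[S]_(mu in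
  counts n.+1 A (fun i => if i == n then j else k i)) (H mu * nexp mu g).
have -> : counts n.+1 A k =
    counts n.+1 A (fun i => if i == n then k n else k i).
  by congr counts; apply/funext => i; case: eqP => [->|].
have a0 H : (forall mu, 0 <= H mu <= 1) -> forall j, 0 <= a H j.
  move=> H01 j; apply: integral_ge0 => mu _.
  by rewrite mule_ge0 ?nexp_ge0//; case/andP: (H01 mu).
have afin H : measurable_fun setT H -> (forall mu, 0 <= H mu <= 1) ->
    \sum_(j <oo) a H j < +oo.
  move=> mH H01.
  (* The sum of the coefficients is the Dirichlet series at t = 0. *)
  have := @split_counts H n A k g 0 mH H01 bA bg.
  rewrite (eq_eseriesr (g := a H)) => [|j _]; last first.
    by rewrite mul0r oppr0 expR0 mul1e.
  move=> <-; apply: (@le_lt_trans _ _ (\int[S]_(mu in counts n A k) cst 1 mu)).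
    apply: ge0_le_integral => //.
    - exact: measurable_counts.
    - move=> mu _; rewrite mule_ge0 ?nexp_ge0//; by case/andP: (H01 mu).
    - apply: measurable_funTS; apply: emeasurable_funM => //.
      apply: measurable_nexp_pm => [|x].
        apply: measurable_funD => //; apply: measurable_funM => //.
        by apply: measurable_indic; case: (bA n).
      by rewrite mul0r addr0.
    move=> mu _; rewrite -[leRHS]mul1e; have /andP[H0 H1] := H01 mu.
    apply: lee_pmul => //; first exact: nexp_ge0.
    by apply: nexp_le1 => x; rewrite mul0r addr0.
  rewrite integral_cst; last exact: measurable_counts.
  rewrite mul1e; apply: (@le_lt_trans _ _ 1); last exact: ltry.
  by apply: probability_le1; exact: measurable_counts.
suff : a F =1 a G by move=> /(_ (k n)).
apply: dirichlet_series_inj; [exact: a0|exact: a0|exact: afin|exact: afin|].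
move=> t; rewrite -!split_counts//; apply: IH => //.
apply: bounded_nonneg_measurableD => //; split.
- apply: measurable_funM => //; apply: measurable_indic.
  by case: (bA n).
- by move=> x; rewrite mulr_ge0.
- by exists t%:R => x; rewrite ler_piMr// indicE; case: (_ \in _).
Qed.

Lemma ae_eq_nexp : ae_eq S setT F G.
Proof.
apply: (ae_eq_pi_system (H := count_events)) => //.
- exact: measurable_count_events.
- exact: setI_closed_count_events.
- exists 0%N, (fun=> set0), (fun=> 0%N); split.
    by move=> _; exact: bounded_borel0.
  by apply/seteqP; split.
move=> _ [n [A [k [bA ->]]]].
have b0 : bounded_nonneg_measurable (fun _ : borel X => 0%R : R).
  by split => //; exists 0%R.
have n0 (mu : pointMeasure X) : nexp mu (fun=> 0%R : R) = 1.
  by rewrite /nexp integral0 oppe0 expeR0.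
have := integral_counts n k bA b0.
under eq_integral do rewrite n0 mule1.
by under [X in _ = X]eq_integral do rewrite n0 mule1.
Qed.

End point_measure_uniqueness.

(** * Bounded limits of a countable lattice of functions *)

Section countable_function_lattice.
Context {R : realType} {T : Type}.

(** Syntax for the functions obtained from countably many generators by the
operations of [lattice_op]; there are countably many terms. *)
Inductive lattice_term :=
  | Gen of nat
  | Combine of option rat & lattice_term & lattice_term.

(** Absolute differences yield complements, and together with linear
combinations they yield maxima, hence unions of sets.  The absolute value of q
keeps all functions nonnegative. *)
Definition lattice_op (q : option rat) (a b : R) : R :=
  if q is Some q then `|ratr q| * a + b else `|a - b|.

Fixpoint lattice_eval (b : nat -> T -> R) (t : lattice_term) : T -> R :=
  match t with
  | Gen n => b n
  | Combine q s t =>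
      fun x => lattice_op q (lattice_eval b s x) (lattice_eval b t x)
  end.

Fixpoint tree_of_term (t : lattice_term) : GenTree.tree (nat + option rat) :=
  match t with
  | Gen n => GenTree.Leaf (inl n)
  | Combine q s t =>
      GenTree.Node 0 [:: GenTree.Leaf (inr q); tree_of_term s; tree_of_term t]
  end.

Fixpoint term_of_tree (t : GenTree.tree (nat + option rat)) : lattice_term :=
  match t with
  | GenTree.Leaf (inl n) => Gen n
  | GenTree.Node _ [:: GenTree.Leaf (inr q); s; t] =>
      Combine q (term_of_tree s) (term_of_tree t)
  | _ => Gen 0
  end.

Lemma tree_of_termK : cancel tree_of_term term_of_tree.
Proof. by elim=> [//|q s IHs t IHt] /=; rewrite IHs IHt. Qed.

Definition term_enum (n : nat) : lattice_term :=
  oapp term_of_tree (Gen 0) (unpickle n).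

Lemma term_enum_surj t : exists n, term_enum n = t.
Proof.
by exists (pickle (tree_of_term t)); rewrite /term_enum pickleK/= tree_of_termK.
Qed.

End countable_function_lattice.

Section bounded_limits.
Context {R : realType} {T : Type} (W : set T) (G : set (T -> R)).

(** Iterated limits are needed: in general one pass of limits does not
reach all measurable sets. *)
Inductive bounded_limit : (T -> R) -> Prop :=
  | bounded_limit_gen f : G f -> bounded_limit f
  | bounded_limit_lim (f : nat -> T -> R) (M : R) g :
      (forall n, bounded_limit (f n)) ->
      (forall n x, 0 <= f n x <= M * \1_W x) ->
      (forall x, f ^~ x @ \oo --> g x) -> bounded_limit g.

Hypothesis G_bounded :
  forall f, G f -> exists M : R, forall x, 0 <= f x <= M * \1_W x.

Lemma bounded_limit_bounded f :
  bounded_limit f -> exists M : R, forall x, 0 <= f x <= M * \1_W x.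
Proof.
elim=> [{}f|{}f M g _ _ fM fg]; first exact: G_bounded.
exists M => x; rewrite -(cvg_lim (@Rhausdorff R) (fg x)).
have cf : cvgn (f ^~ x) by apply/cvg_ex; exists (g x); exact: fg.
by apply/andP; split; [apply: limr_ge|apply: limr_le] => //;
  apply: nearW => n; case/andP: (fM n x).
Qed.

(** The usual two-step argument: with g a generator, the f such that
op f g is a bounded limit are stable under bounded limits; then the same holds
in g, with f an arbitrary bounded limit. *)
Lemma bounded_limit_op (op : R -> R -> R) (C : R) :
  0 <= C ->
  (forall a b, 0 <= a -> 0 <= b -> 0 <= op a b <= C * (a + b)) ->
  (forall (u : nat -> R) a b, u @ \oo --> a ->
    op (u n) b @[n --> \oo] --> op a b) ->
  (forall (u : nat -> R) a b, u @ \oo --> b ->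
    op a (u n) @[n --> \oo] --> op a b) ->
  (forall f g, G f -> G g -> bounded_limit (fun x => op (f x) (g x))) ->
  forall f g, bounded_limit f -> bounded_limit g ->
  bounded_limit (fun x => op (f x) (g x)).
Proof.
move=> C0 opC opl opr opG.
have bound M N a b x : 0 <= a <= M * \1_W x -> 0 <= b <= N * \1_W x ->
    0 <= op a b <= C * (M + N) * \1_W x.
  move=> /andP[a0 aM] /andP[b0 bN].
  have /andP[-> /le_trans ->//] := opC a b a0 b0.
  by rewrite -mulrA mulrDl ler_wpM2l// lerD.
have opGl f g : G f -> bounded_limit g ->
    bounded_limit (fun x => op (f x) (g x)).
  move=> Gf; elim=> [{}g|{}g M g' _ IH gM gg']; first exact: opG.
  have [N fN] := G_bounded Gf.
  apply: (bounded_limit_lim (M := C * (N + M)) IH) => [n x|x].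
    exact: bound (fN x) (gM n x).
  by apply: opr; exact: gg'.
move=> f g bf bg; elim: bf => [{}f Gf|{}f M f' _ IH fM ff']; first exact: opGl.
have [N gN] := bounded_limit_bounded bg.
apply: (bounded_limit_lim (M := C * (M + N)) IH) => [n x|x].
  exact: bound (fM n x) (gN x).
by apply: opl; exact: ff'.
Qed.

End bounded_limits.

Section bounded_limits_of_lattice.
Context {R : realType} {X : polishMetricType R}.
Variables (W : set (borel X)) (U : nat -> set X).
Hypothesis U_base : forall O : set X, open O ->
  O = \bigcup_(i in [set i | U i `<=` O]) U i.

(** The index 0 stands for W itself. *)
Definition base_indicator (n : nat) : borel X -> R :=
  \1_(W `&` (if n is m.+1 then U m else setT)).

Notation G := (range (lattice_eval base_indicator)).
Notation BL := (bounded_limit W G).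

Lemma base_indicator_bounded n x : 0 <= base_indicator n x <= 1 * \1_W x.
Proof.
by rewrite /base_indicator indicI mul1r /= mulr_ge0//= ler_piMr.
Qed.

Lemma lattice_eval_bounded f : G f ->
  exists M : R, forall x, 0 <= f x <= M * \1_W x.
Proof.
move=> [t _ <-]; elim: t => [n|q s [M sM] t [N tN]] /=.
  by exists 1 => x; exact: base_indicator_bounded.
exists ((if q is Some q then `|ratr q| * M else M) + N) => x.
have /andP[s0 sMx] := sM x; have /andP[t0 tNx] := tN x.
rewrite mulrDl; case: q => [q|] /=.
  by rewrite addr_ge0 ?mulr_ge0//= -mulrA lerD// ler_wpM2l.
rewrite normr_ge0/= (le_trans (ler_normB _ _))// !ger0_norm//.
exact: lerD.
Qed.

Lemma measurable_lattice_eval t :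
  (forall n, measurable_fun setT (base_indicator n)) ->
  measurable_fun setT (lattice_eval base_indicator t).
Proof.
move=> mb; elim: t => [n|[q|] s ms t mt] /=; first exact: mb.
  by apply: measurable_funD => //; exact: measurable_funM.
by apply: measurableT_comp => //; exact: measurable_funB.
Qed.

Let G_op q f g : G f -> G g -> G (fun x => lattice_op q (f x) (g x)).
Proof. by move=> [s _ <-] [t _ <-]; exists (Combine q s t). Qed.

Let BL_absdiff f g : BL f -> BL g -> BL (fun x => `|f x - g x|).
Proof.
apply: (bounded_limit_op lattice_eval_bounded (op := fun a b => `|a - b|)
  (C := 1)).
- by [].
- move=> a b a0 b0; rewrite normr_ge0 mul1r/= (le_trans (ler_normB _ _))//.
  by rewrite !ger0_norm.
- by move=> u a b ua; apply: cvg_norm; apply: cvgB => //; exact: cvg_cst.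
- by move=> u a b ub; apply: cvg_norm; apply: cvgB => //; exact: cvg_cst.
- by move=> f' g' Gf Gg; apply: bounded_limit_gen; exact: (G_op None).
Qed.

Let BL_ratD (q : rat) f g : BL f -> BL g -> BL (fun x => `|ratr q| * f x + g x).
Proof.
apply: (bounded_limit_op lattice_eval_bounded
  (op := fun a b => `|ratr q| * a + b) (C := `|ratr q| + 1)).
- by [].
- move=> a b a0 b0; rewrite addr_ge0 ?mulr_ge0//= mulrDl mul1r lerD//.
    by rewrite ler_wpM2l// lerDl.
  by rewrite lerDr.
- move=> u a b ua; apply: cvgD; last exact: cvg_cst.
  by apply: cvgM => //; exact: cvg_cst.
- by move=> u a b ub; apply: cvgD => //; exact: cvg_cst.
- by move=> f' g' Gf Gg; apply: bounded_limit_gen; exact: (G_op (Some q)).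
Qed.

Let BL_ext f g : BL f -> f =1 g -> BL g.
Proof. by move=> bf /funext <-. Qed.

Let BL_W : BL \1_W.
Proof.
apply: (BL_ext (f := base_indicator 0)).
  by apply: bounded_limit_gen; exists (Gen 0).
by move=> x; rewrite /base_indicator setIT.
Qed.

Let BL_0 : BL (fun=> 0).
Proof.
by apply: BL_ext (BL_absdiff BL_W BL_W) _ => x; rewrite subrr normr0.
Qed.

Let BL_add f g : BL f -> BL g -> BL (fun x => f x + g x).
Proof.
move=> bf bg; apply: BL_ext (BL_ratD 1 bf bg) _ => x.
by rewrite rmorph1 normr1 mul1r.
Qed.

(** Real multiples are limits of rational ones, approaching c from above. *)
Let BL_scale c f : 0 <= c -> BL f -> BL (fun x => c * f x).
Proof.
move=> c0 bf.
have /choice[q cq] : forall n, exists q : rat,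
    (ratr q : R) \in `]c, c + n.+1%:R^-1[.
  by move=> n; apply: rat_in_itvoo; rewrite ltrDl invr_gt0.
have [M fM] := bounded_limit_bounded lattice_eval_bounded bf.
have q_ge n : c <= ratr (q n).
  by have := cq n; rewrite in_itv/= => /andP[/ltW].
have q_le n : ratr (q n) <= c + n.+1%:R^-1.
  by have := cq n; rewrite in_itv/= => /andP[_ /ltW].
have q0 n : `|ratr (q n)| = ratr (q n) :> R.
  by rewrite ger0_norm// (le_trans c0).
have q_cvg : `|ratr (q n) : R| @[n --> \oo] --> c.
  apply: (squeeze_cvgr (f := fun=> c) (h := fun n => c + n.+1%:R^-1)).
  - by apply: nearW => n; rewrite q0 q_ge q_le.
  - exact: cvg_cst.
  - rewrite -[X in _ --> X]addr0; apply: cvgD; first exact: cvg_cst.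
    exact: cvg_harmonic.
apply: (bounded_limit_lim (f := fun n x => `|ratr (q n)| * f x + 0)
  (M := (c + 1) * M)).
- by move=> n; exact: BL_ratD.
- move=> n x; have /andP[f0 fMx] := fM x; rewrite addr0 mulr_ge0//= -mulrA.
  rewrite ler_pM// q0 (le_trans (q_le n))// lerD2l.
  by rewrite invf_le1// ler1n.
- move=> x; rewrite -[X in _ --> X]addr0; apply: cvgD; last exact: cvg_cst.
  by apply: cvgM => //; exact: cvg_cst.
Qed.

(** The maximum of a and b is half of a + b + |a - b|. *)
Let BL_setU (A B : set (borel X)) :
  BL \1_(W `&` A) -> BL \1_(W `&` B) -> BL \1_(W `&` (A `|` B)).
Proof.
move=> bA bB.
have half0 : 0 <= 2^-1 :> R by rewrite invr_ge0.
have := BL_scale half0 (BL_add (BL_add bA bB) (BL_absdiff bA bB)).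
move=> /BL_ext; apply => x.
rewrite !indicE !in_setI in_setU.
by case: (x \in W); case: (x \in A); case: (x \in B) => /=;
  rewrite ?mul1r ?mul0r ?addr0 ?add0r ?subrr ?subr0 ?sub0r ?normrN ?normr1
    ?normr0 ?addr0 ?mulr0// mulVf.
Qed.

Let BL_bigcup (F : nat -> set (borel X)) :
  (forall n, BL \1_(W `&` F n)) -> BL \1_(W `&` \bigcup_n F n).
Proof.
move=> bF.
have bU n : BL \1_(W `&` \big[setU/set0]_(i < n) F i).
  elim: n => [|n IH].
    by apply: BL_ext BL_0 _ => x; rewrite big_ord0 setI0 indicE in_set0.
  by rewrite big_ord_recr/=; exact: BL_setU.
apply: (bounded_limit_lim (M := 1) bU).
  by move=> n x; rewrite indicI mul1r mulr_ge0//= ler_piMr.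
move=> x; apply: cvg_near_cst.
have [[i _ Fix]|nF] := pselect ((\bigcup_i F i) x).
  exists i.+1 => //= n /= iN; rewrite !indicE !in_setI -bigcup_mkord.
  have -> : x \in \bigcup_i F i by apply/mem_set; exists i.
  by have -> : x \in \bigcup_(i < n) F i by apply/mem_set; exists i.
apply: nearW => n; rewrite !indicE !in_setI -bigcup_mkord (memNset nF).
rewrite (_ : x \in \bigcup_(i < n) F i = false)//.
by apply/memNset => -[i _ Fix]; apply: nF; exists i.
Qed.

(** The sets whose trace on W has its indicator among the bounded limits form a
sigma-algebra, which contains the base, hence all open sets. *)
Let BL_sets (A : set (borel X)) : measurable A -> BL \1_(W `&` A).
Proof.
suff : @measurable _ (borel X) `<=` [set A | BL \1_(W `&` A)] by exact.
apply: smallest_sub => /=.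
  split.
  - by apply: BL_ext BL_0 _ => x; rewrite setI0 indicE in_set0.
  - move=> E bE; apply: BL_ext (BL_absdiff BL_W bE) _ => x /=.
    rewrite setTD !indicE !in_setI in_setC.
    by case: (x \in W); case: (x \in E) => /=;
      rewrite ?mul1r ?mul0r ?subrr ?subr0 ?normr1 ?normr0.
  - exact: BL_bigcup.
move=> O oO; rewrite /= (U_base oO).
pose V n := if pselect (U n `<=` O) then U n else set0.
have -> : \bigcup_(i in [set i | U i `<=` O]) U i = \bigcup_n V n.
  apply/seteqP; split => x.
    by move=> [i /= UiO Ux]; exists i => //; rewrite /V; case: pselect.
  by move=> [i _]; rewrite /V; case: pselect => // UiO Ux; exists i.
have bV n : BL \1_(W `&` V n).
  rewrite /V; case: pselect => ?.
    by apply: bounded_limit_gen; exists (Gen n.+1).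
  by apply: BL_ext BL_0 _ => x; rewrite setI0 indicE in_set0.
exact: BL_bigcup.
Qed.

Lemma bounded_limit_step h : step_function h -> BL (fun x => h x * \1_W x).
Proof.
move=> [n [A [c [bA _ c0 hE]]]].
apply: (BL_ext (f := fun x => \sum_(i < n) c i * \1_(W `&` A i) x)).
  elim: n {hE} => [|n IH]; first by apply: BL_ext BL_0 _ => x; rewrite big_ord0.
  apply: (BL_ext (f := fun x => (\sum_(i < n) c i * \1_(W `&` A i) x) +
      c n * \1_(W `&` A n) x)).
    by apply: BL_add => //; apply: BL_scale => //; apply: BL_sets; case: (bA n).
  by move=> x; rewrite big_ord_recr.
move=> x; rewrite hE mulr_suml; apply: eq_bigr => i _.
by rewrite indicI /= -mulrA; congr (_ * _); rewrite mulrC.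
Qed.

Lemma bounded_limit_measurable h : bounded_nonneg_measurable h ->
  BL (fun x => h x * \1_W x).
Proof.
move=> [mh h0 [M hM]].
have [f [sf _ fh _ cf]] := step_function_approximation mh h0.
apply: (bounded_limit_lim (f := fun n x => f n x * \1_W x) (M := M)).
- by move=> n; exact: bounded_limit_step.
- move=> n x; have /andP[f0 fhx] := fh n x.
  by rewrite mulr_ge0//= ler_wpM2r// (le_trans fhx).
- by move=> x; apply: cvgM; [exact: cf|exact: cvg_cst].
Qed.

End bounded_limits_of_lattice.

(** * Extension from countably many test functions *)

Section second_countability.
Context {R : realType} (X : polishMetricType R).

(** The balls of radius 1 / k.+1 centred in a countable dense set.  The centres
are numbered by an injection f into the integers, so that the set of index
(i, k) is the ball about the centre number i, or is empty. *)
Lemma countable_base : exists U : nat -> set X,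
  (forall n, open (U n)) /\
  forall O : set X, open O -> O = \bigcup_(i in [set i | U i `<=` O]) U i.
Proof.
have [A cA dA] := @separable_dense R X.
have /countable_injP[f finj] := cA.
pose ball_at (p : nat * nat) : set X :=
  \bigcup_(a in [set a | A a /\ f a = p.1]) ball a p.2.+1%:R^-1.
pose U n := oapp ball_at set0 (unpickle n).
exists U; split.
  move=> n; rewrite /U; case: unpickle => [p|] /=; last exact: open0.
  by apply: bigcup_open => a _; exact: metric_ball_open.
move=> O oO; apply/seteqP; split => x; last by move=> [i /= UO Ux]; exact: UO.
move=> Ox; have /nbhs_ballP[e /= e0 eO] : nbhs x O by exact: open_nbhs_nbhs.
(* Two steps of length 1 / k.+1 stay within e. *)
pose k := Num.truncn (2 / e).
have ke : k.+1%:R^-1 < e / 2.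
  rewrite -[ltRHS]invrK ltf_pV2 ?posrE ?invr_gt0 ?divr_gt0//.
  by rewrite invf_div truncnS_gt.
have k0 : 0 < k.+1%:R^-1 :> R by rewrite invr_gt0.
have [a [xa Aa]] : ball x k.+1%:R^-1 `&` A !=set0.
  by apply: dA; [exists x; exact: ballxx|exact: metric_ball_open].
have UE : U (pickle (f a, k)) = ball_at (f a, k) by rewrite /U pickleK.
exists (pickle (f a, k)) => /=; rewrite UE; last first.
  by exists a => //=; exact: ball_sym.
move=> y [b [Ab /= fba] by_]; have ba : b = a by apply: finj; rewrite ?inE.
apply: eO; rewrite ba in by_.
apply: (@le_ball _ _ _ (k.+1%:R^-1 + k.+1%:R^-1));
  last exact: ball_triangle by_.
by rewrite (splitr e) lerD// ltW.
Qed.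

End second_countability.

(** Q stands for the posterior at a fixed configuration mu, and m for
rho + mu. *)
Section determination.
Local Open Scope ereal_scope.
Context {R : realType} {X : polishMetricType R}.
Variables (Q : {measure set (lfMeasure X) -> \bar R}) (m : lfMeasure X) (z : R).
Hypothesis z0 : (0 <= z)%R.
Hypothesis QT : Q setT < +oo.

Definition gamma_laplace_at (h : borel X -> R) : Prop :=
  laplace Q h = nexp m (fun x => ln (1 + z * h x))%R.

Let cvg_ln1D (u : nat -> R) (l : R) : (0 <= l)%R -> u @ \oo --> l ->
  ln (1 + z * u n)%R @[n --> \oo] --> ln (1 + z * l)%R.
Proof.
move=> l0 ul; apply: (@continuous_cvg _ _ _ _ _ _ (@ln R)).
  by apply: continuous_ln; rewrite ltr_wpDr// mulr_ge0.
by apply: cvgD; [exact: cvg_cst|apply: cvgM => //; exact: cvg_cst].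
Qed.

(** Along functions dominated by a multiple of the indicator of a bounded set,
both sides of the equality are continuous by dominated convergence, first under
each locally finite measure, then under Q. *)
Let gamma_laplace_bounded_limit (W : set (borel X)) (G : set (borel X -> R)) :
  bounded_borel W ->
  (forall f, G f -> measurable_fun setT f) ->
  (forall f, G f -> exists M, forall x, (0 <= f x <= M * \1_W x)%R) ->
  (forall f, G f -> gamma_laplace_at f) ->
  forall f, bounded_limit W G f -> measurable_fun setT f /\ gamma_laplace_at f.
Proof.
move=> bW mG bG dG f; elim=> [{}f Gf|{}f M g _ IH fM fg].
  by split; [exact: mG|exact: dG].
have mf n : measurable_fun setT (f n) by case: (IH n).
have f0 n x : (0 <= f n x)%R by case/andP: (fM n x).
have mg : measurable_fun setT g.
  by apply: measurable_fun_cvg mf _ => x _; exact: fg.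
have g0 x : (0 <= g x)%R.
  rewrite -(cvg_lim (@Rhausdorff R) (fg x)); apply: limr_ge; last exact: nearW.
  by apply/cvg_ex; exists (g x); exact: fg.
have mW : measurable W by case: bW.
split => //; apply: (@cvg_unique _ (@ereal_hausdorff R)
    (laplace Q (f n) @[n --> \oo])).
  apply: cvg_integral_le1 => // [n||n kappa|kappa].
  - exact: measurable_nexp_lf.
  - exact: measurable_nexp_lf.
  - by rewrite nexp_ge0 nexp_le1.
  - apply: (cvg_nexp_dominated mW _ mf fM fg); exact: lf_bounded.
rewrite /= (_ : (fun n => laplace Q (f n)) =
    (fun n => nexp m (fun x => ln (1 + z * f n x))%R)); last first.
  by apply/funext => n; case: (IH n).
apply: (cvg_nexp_dominated (M := (z * M)%R) mW).
- exact: lf_bounded.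
- by move=> n; exact: measurable_ln1D.
- move=> n x; rewrite ln1D_ge0//=; have /andP[_ fMx] := fM n x.
  rewrite -mulrA (le_trans _ (ler_wpM2l z0 fMx))//.
  have p : (0 < 1 + z * f n x)%R by rewrite ltr_wpDr// mulr_ge0.
  by rewrite -ler_expR lnK ?posrE// expR_ge1Dx.
- by move=> x; apply: cvg_ln1D.
Qed.

(** The functions supported in a ball are bounded limits of the countable
lattice; the general case follows by letting the ball grow. *)
Lemma gamma_laplace_determined (U : nat -> set X) :
  (forall n, open (U n)) ->
  (forall O : set X, open O -> O = \bigcup_(i in [set i | U i `<=` O]) U i) ->
  (forall n t,
    gamma_laplace_at (lattice_eval (base_indicator (point_ball n) U) t)) ->
  forall h, bounded_nonneg_measurable h -> gamma_laplace_at h.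
Proof.
move=> oU bU dG h bh; have [mh h0 [M hM]] := bh.
have mc n : measurable (point_ball n : set (borel X)).
  by case: (@bounded_point_ball R X n).
have mU n : measurable (U n : set (borel X)) by exact: sub_sigma_algebra.
have mb n i : measurable_fun setT (base_indicator (point_ball n) U i).
  by apply: measurable_indic; apply: measurableI => //; case: i.
have hn n : measurable_fun setT (fun x => h x * \1_(point_ball n) x)%R /\
    gamma_laplace_at (fun x => h x * \1_(point_ball n) x)%R.
  apply: (gamma_laplace_bounded_limit (bounded_point_ball n) _ _ _
    (bounded_limit_measurable (point_ball n) bU bh)).
  - move=> _ [t _ <-]; exact: measurable_lattice_eval.
  - exact: lattice_eval_bounded.
  - by move=> _ [t _ <-].
have hx0 n x : (0 <= h x * \1_(point_ball n) x)%R by rewrite mulr_ge0.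
have ndh x : nondecreasing_seq (fun n => h x * \1_(point_ball n) x)%R.
  by move=> i j ij; rewrite ler_wpM2l// indic_point_ball_nondecreasing.
have ch x : (h x * \1_(point_ball n) x)%R @[n --> \oo] --> h x.
  by apply: (cvg_indic_point_ball (f := fun=> h)); exact: cvg_cst.
apply: (@cvg_unique _ (@ereal_hausdorff R)
    (laplace Q (fun x => h x * \1_(point_ball n) x)%R @[n --> \oo])).
  apply: cvg_integral_le1 => // [n||n kappa|kappa].
  - by apply: measurable_nexp_lf => //; case: (hn n).
  - exact: measurable_nexp_lf.
  - by rewrite nexp_ge0 nexp_le1.
  - by apply: cvg_nexp_monotone => // n; case: (hn n).
rewrite /= (_ : (fun n => laplace Q _) = (fun n =>
    nexp m (fun x => ln (1 + z * (h x * \1_(point_ball n) x)))%R)); last first.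
  by apply/funext => n; case: (hn n).
apply: cvg_nexp_monotone.
- by move=> n; apply: measurable_ln1D; case: (hn n).
- by move=> n x; rewrite ln1D_ge0.
- move=> x i j ij.
  by rewrite ler_ln ?posrE ?ltr_wpDr ?mulr_ge0// lerD2l ler_wpM2l// ndh.
- by move=> x; apply: cvg_ln1D.
Qed.

End determination.

(** * The posterior law *)

Section lattice_test_functions.
Context {R : realType} {X : polishMetricType R}.
Variables (W : set (borel X)) (U : nat -> set X).
Hypothesis mW : measurable W.
Hypothesis oU : forall n, open (U n).

Lemma bounded_nonneg_measurable_lattice t :
  bounded_nonneg_measurable (lattice_eval (base_indicator W U) t).
Proof.
have [|M hM] := @lattice_eval_bounded _ _ W U
    (lattice_eval (base_indicator W U) t).
  by exists t.
split.
- apply: measurable_lattice_eval => n; apply: measurable_indic.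
  apply: measurableI => //; case: n => // n; apply: sub_sigma_algebra.
  exact: oU.
- by move=> x; case/andP: (hM x).
- exists `|M| => x; have /andP[_ /le_trans] := hM x; apply.
  by rewrite indicE; case: (_ \in _); rewrite ?mulr1 ?mulr0 ?ler_norm.
Qed.

End lattice_test_functions.

Section bayes_laplace_ae.
Local Open Scope ereal_scope.
Context {R : realType} {X : polishMetricType R}.

(** Both sides are functions of mu with values in [0, 1] that have the same
integrals against all exponential test functions. *)
Lemma bayes_laplace_ae (z : R) (rho : lfMeasure X) (hz : (0 < z < 1)%R)
    (P : lfMeasure X -> probability (pointMeasure X) R)
    (hP : forall kappa, is_poisson_process kappa (P kappa))
    (D : probability (lfMeasure X) R) (hD : is_poisson_gamma z rho D)
    (S : probability (pointMeasure X) R)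
    (B : R.-pker (pointMeasure X) ~> (lfMeasure X))
    (hB : is_bayes_kernel P D S B) (h : borel X -> R) :
  bounded_nonneg_measurable h ->
  {ae S, forall mu : pointMeasure X,
    gamma_laplace_at (B mu) (lf_add rho mu) z h}.
Proof.
move=> bh; have [mh h0 _] := bh; have /andP[z0 _] := hz.
pose l x := ln (1 + z * h x).
have ml : measurable_fun setT l by exact: measurable_ln1D.
have l0 x : (0 <= l x)%R by rewrite ln1D_ge0// ltW.
have : ae_eq S setT (fun mu => laplace (B mu) h)
    (fun mu : pointMeasure X => nexp (lf_add rho mu) l).
  apply: ae_eq_nexp.
  - exact: measurable_laplace_kernel.
  - apply: eq_measurable_fun
      (measurable_funeM (nexp rho l) (measurable_nexp_pm ml l0)).
    by move=> mu _; rewrite nexp_lf_add.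
  - move=> mu; rewrite integral_ge0//=; last by move=> *; exact: nexp_ge0.
    rewrite -(@prob_kernel _ _ _ _ _ B mu) -[leRHS]mul1e -integral_cst//.
    apply: ge0_le_integral => //.
    + by move=> kappa _; exact: nexp_ge0.
    + exact: measurable_nexp_lf.
    + by move=> kappa _; exact: nexp_le1.
  - by move=> mu; rewrite nexp_ge0 nexp_le1.
  - by move=> g bg; exact: (bayes_laplace hz hP hD hB bg bh).
by apply: filterS => mu /(_ I).
Qed.

End bayes_laplace_ae.

Theorem theorem2p1 (R : realType) (X : polishMetricType R)
    (z : R) (hz : 0 < z < 1) (rho : lfMeasure X)
    (P : lfMeasure X -> probability (pointMeasure X) R)
    (hP : forall kappa, is_poisson_process kappa (P kappa))
    (D : probability (lfMeasure X) R) (hD : is_poisson_gamma z rho D)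
    (S : probability (pointMeasure X) R) (hS : is_polya_sum z rho S)
    (B : R.-pker (pointMeasure X) ~> (lfMeasure X))
    (hB : is_bayes_kernel P D S B) :
  {ae S, forall mu : pointMeasure X,
    is_poisson_gamma (z / (1 + z)) (lf_add rho mu) (B mu)}.
Proof.
have /andP[z0 z1] := hz; have [U [oU bU]] := countable_base X.
have mc n : measurable (point_ball n : set (borel X)).
  by case: (@bounded_point_ball R X n).
have := ae_foralln (fun n => ae_foralln (fun k => bayes_laplace_ae hz hP hD hB
  (bounded_nonneg_measurable_lattice (mc n) oU (term_enum k)))).
apply: filterS => mu hmu.
have z01 : 0 < z / (1 + z) < 1.
  by rewrite divr_gt0 ?addr_gt0//= ltr_pdivrMr ?addr_gt0// mul1r ltrDr.
apply/(is_poisson_gamma_nexp _ _ z01) => g bg.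
have -> : z / (1 + z) / (1 - z / (1 + z)) = z.
  by field; rewrite gt_eqF ?addr_gt0//= addrK oner_neq0.
apply: (gamma_laplace_determined (ltW z0) _ oU bU _ bg).
  by rewrite prob_kernel ltry.
by move=> n t; have [k <-] := term_enum_surj t; exact: hmu.
Qed.
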